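(* Let $k\ge 2$, $R>1$, and let $\mathcal{D}$ be a distribution over $\mathbb{R}$ with mean $\mu\in[-R,R]$ and $\mathbb{E}_{X\sim\mathcal{D}}[|X-\mu|^k]\le 1$. Then for all $\varepsilon,\delta,\rho,\alpha,\beta>0$ there exist an $(\varepsilon,\delta)$-differentially private algorithm and a $\rho$-zCDP algorithm which take, respectively, $$n_{(\varepsilon,\delta)} \geq c\left(\frac{\log(1/\beta)}{\alpha^2}+\frac{\log(1/\beta)}{\varepsilon\,\alpha^{k/(k-1)}}+\frac{\log(1/\delta)\log(1/\beta)}{\varepsilon}\right)$$ and $$n_\rho \geq c\left(\frac{\log(1/\beta)}{\alpha^2}+\frac{\log(1/\beta)}{\sqrt{\rho}\,\alpha^{k/(k-1)}}+\frac{\sqrt{\log R}\,\log(1/\beta)}{\sqrt\rho}\right)$$ i.i.d. samples from $\mathcal{D}$ (for a suitable absolute constant $c$), and output $\hat\mu\in\mathbb{R}$ such that with probability at least $1-\beta$, $|\mu-\hat\mu|\le\alpha$.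
   Context: A randomized algorithm $M$ is $(\varepsilon,\delta)$-differentially private if for all datasets $X,X'$ differing in exactly one entry and every measurable output set $Y$, $\Pr[M(X)\in Y]\le e^\varepsilon\Pr[M(X')\in Y]+\delta$. It is $\rho$-zCDP if for all such $X,X'$ and all $\alpha\in(1,\infty)$, $D_\alpha(M(X)\|M(X'))\le\rho\alpha$, where $D_\alpha$ is the Rényi divergence of order $\alpha$.
   Formalization: The formal theorem assumes δ ≤ 1, α ≤ 1 and β ≤ 1/2; for arbitrary positive δ, α, β the stated sample bounds fail for every absolute constant c. The algorithm is chosen before, and works for, every distribution D. *)

(* Defs.v *)
From HB Require Import structures.
From mathcomp Require Import all_boot all_order all_algebra.
From mathcomp Require Import all_classical all_reals all_analysis.

Set Implicit Arguments.
Unset Strict Implicit.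
Unset Printing Implicit Defensive.

Import Order.TTheory GRing.Theory Num.Theory.

Local Open Scope classical_set_scope.
Local Open Scope ring_scope.
Local Open Scope charge_scope.

Section Privacy.
Context {R : realType}.

Definition dataset (n : nat) := n.-tuple R.

Definition neighbors n (x y : dataset n) : Prop :=
  #|[pred i : 'I_n | tnth x i != tnth y i]| = 1%N.

(* A randomized algorithm is a Markov kernel: [M x] is the law of its output on
   the dataset [x], and it depends measurably on [x]. *)
Definition randomized_algorithm (n : nat) :=
  {mfun dataset n >-> pprobability R R}.

Definition output_law n (M : randomized_algorithm n) (x : dataset n) :
  probability R R := M x.

Definition differentially_private n (eps delta : R)
    (M : randomized_algorithm n) : Prop :=
  forall x y : dataset n, neighbors x y ->
  forall Y : set R, measurable Y ->
  (output_law M x Y <= (expR eps)%:E * output_law M y Y + delta%:E)%E.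

(* Used for orders [a > 1] only: the divergence is then infinite when [p] is not
   absolutely continuous with respect to [q]. *)
Definition renyi_divergence d (T : measurableType d) (a : R)
    (p q : probability T R) : \bar R :=
  if `[< p `<< q >] then
    (((a - 1)^-1)%:E *
     lne (\int[q]_x ('d (charge_of_finite_measure p) '/d q) x `^ a))%E
  else +oo%E.

Definition zCDP n (rho : R) (M : randomized_algorithm n) : Prop :=
  forall x y : dataset n, neighbors x y ->
  forall a : R, 1 < a ->
  (renyi_divergence a (output_law M x) (output_law M y) <= (rho * a)%:E)%E.

Definition has_mean (D : probability R R) (mu : R) : Prop :=
  D.-integrable setT EFin /\ (\int[D]_x x%:E = mu%:E)%E.

Definition abs_central_moment (D : probability R R) (mu k : R) : \bar R :=
  (\int[D]_x (`|x - mu| `^ k)%:E)%E.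

Definition mutually_independent d (Omega : measurableType d)
    (P : probability Omega R) n (X : 'I_n -> {RV P >-> R}) : Prop :=
  forall (J : {set 'I_n}) (B : 'I_n -> set R),
    (forall i, measurable (B i)) ->
    (P (\bigcap_(i in [set` J]) (X i @^-1` B i)) =
     \prod_(i in J) P (X i @^-1` B i))%E.

Definition iid_samples d (Omega : measurableType d) (P : probability Omega R)
    (D : probability R R) n (X : 'I_n -> {RV P >-> R}) : Prop :=
  mutually_independent X /\
  (forall i (A : set R), measurable A -> distribution P (X i) A = D A).

(* The probability, over both the sample [X 0, ..., X n.-1] and the internal
   randomness of [M], that the output of [M] lies in [Y]. *)
Definition output_prob d (Omega : measurableType d) (P : probability Omega R) n
    (X : 'I_n -> {RV P >-> R}) (M : randomized_algorithm n)
    (Y : set R) : \bar R :=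
  (\int[P]_w output_law M [tuple X i w | i < n] Y)%E.

(* [M] estimates the mean within [alpha] with probability at least [1 - beta],
   simultaneously for every distribution with mean in [[-r, r]] and [k]-th
   absolute central moment at most 1. *)
Definition estimates_mean (k r alpha beta : R) n (M : randomized_algorithm n) :
    Prop :=
  forall (D : probability R R) (mu : R),
    has_mean D mu -> - r <= mu <= r -> (abs_central_moment D mu k <= 1)%E ->
  forall (d : measure_display) (Omega : measurableType d)
    (P : probability Omega R) (X : 'I_n -> {RV P >-> R}),
    iid_samples D X ->
    ((1 - beta)%:E <=
       output_prob X M [set muhat : R | (`|mu - muhat| <= alpha)%R])%E.

End Privacy.
Arguments dataset : clear implicits.
Arguments randomized_algorithm : clear implicits.

(* Main.v *)
(**
The estimator has two stages, both of finite support.  Samples are rounded to a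
grid of step [alpha / 16] covering [[-(r + T), r + T]], where
[T = 1088 * alpha `^ (- (k - 1)^-1)], so that a dataset becomes a point of a
finite set.

Fine stage: given a bin of width [T] close to the mean, clip the samples to a
window of radius [2 * T] around it, average, and choose a grid point by the
exponential mechanism for the distance to the clipped mean.  This is pure
differential privacy, and the noise is of order [T / (eps * n)] whatever the
number of grid points.  Clipping at scale [T] costs a bias of at most a fraction
of [alpha], and since the clipped samples have variance [O(1)] and
[alpha * T = O(1)], an exponential moment bound gives failure probability
[exp (- Omega (n * alpha ^+ 2))] directly, without a median of means.

Coarse stage, finding the bin.  In the [(eps, delta)] case it is a stable
histogram, i.e. an exponential mechanism whose weights vanish on bins holding at
most a quarter of the samples.  In the zCDP case the bins are labelled by
codewords of length [O(log #bins)] with small pairwise agreement; each coordinate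
of the codeword is voted on by its own exponential mechanism, with privacy budget
[rho / length], and the nearest codeword is output.  The mean may lie near the
border of two bins, and then every reported coordinate agrees with one of two
codewords, so a large alphabet is used to keep all other codewords farther away.

Pure [e]-differential privacy implies [4 * e ^+ 2]-zCDP, Renyi moments multiply
over independent coordinates and over the two stages, and by Jensen they do not
increase when the coarse output is discarded.
*)
From HB Require Import structures.
Require Import Defs.
From mathcomp Require Import all_boot all_order all_algebra.
From mathcomp Require Import all_classical all_reals all_analysis.
From mathcomp Require Import measurable_realfun ring lra zify.

Set Implicit Arguments.
Unset Strict Implicit.
Unset Printing Implicit Defensive.

Import Order.TTheory GRing.Theory Num.Theory.

Local Open Scope ring_scope.

(** * Renyi moments and the exponential mechanism *)

Section RealInequalities.
Context {R : realType}.
Implicit Types a u v x y : R.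

(** Multiply [1 - v <= expR (- v)] by [expR v], and note that [(1 + v + 2 * v ^+ 2) * (1 - v) = 1 +
    v ^+ 2 * (1 - 2 * v)] is at least 1. *)
Lemma expR_le1DxD2sqr v : v <= 1 / 2 -> expR v <= 1 + v + 2 * v ^+ 2.
Proof.
move=> v2.
have e1 : 1 - v <= expR (- v) by exact: expR_ge1Dx.
have e0 : 0 < expR v := expR_gt0 v.
have eN : expR v * expR (- v) = 1 by rewrite -expRD subrr expR0.
have h : 0 <= v ^+ 2 * (1 - 2 * v) by apply: mulr_ge0; [exact: sqr_ge0|lra].
have h1 : expR v * (1 - v) <= 1 by rewrite -[leRHS]eN ler_pM2l.
have h2 : 1 <= (1 + v + 2 * v ^+ 2) * (1 - v).
  have -> : (1 + v + 2 * v ^+ 2) * (1 - v) = 1 + v ^+ 2 * (1 - 2 * v) by ring.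
  by lra.
rewrite -(@ler_pM2r _ (1 - v)); last by lra.
exact: le_trans h1 h2.
Qed.

(** Young's inequality for [u * 1] with conjugate exponents [a] and [a / (a - 1)]: the power
    function lies above its tangent at 1. *)
Lemma bernoulli_powR a u : 0 <= u -> 1 < a -> a * u <= u `^ a + (a - 1).
Proof.
move=> u0 a1.
have a0 : 0 < a by lra.
have a10 : 0 < a - 1 by lra.
have q0 : 0 < a / (a - 1) by rewrite divr_gt0.
have := @conjugate_powR R u 1 a (a / (a - 1)) u0 ler01 a0 q0 _.
rewrite powR1 mulr1 mul1r invf_div => /(_ _)/wrap[]; first by field; lra.
move=> H; have := ler_wpM2l (ltW a0) H.
rewrite mulrDr [a * (_ / a)]mulrC divfK ?gt_eqF//.
by rewrite [a * (_ / a)]mulrC divfK ?gt_eqF.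
Qed.

Lemma powR_prod (I : finType) a (f : I -> R) : (forall i, 0 <= f i) ->
  (\prod_i f i) `^ a = \prod_i f i `^ a.
Proof.
move=> f0; suff [] : 0 <= \prod_i f i /\
    (\prod_i f i) `^ a = \prod_i f i `^ a by [].
elim/big_rec2 : _ => [|i x y _ [y0 yx]]; first by rewrite powR1.
by rewrite powRM// yx mulr_ge0.
Qed.

Lemma ler_sum_inj (I J : finType) (f : I -> J) (P : pred I) (F : J -> R) :
  {in P &, injective f} -> (forall j, 0 <= F j) ->
  \sum_(i | P i) F (f i) <= \sum_j F j.
Proof.
move=> fI F0; have -> : \sum_(i | P i) F (f i) = \sum_(i in P) F (f i) by [].
rewrite -big_imset//= [leRHS](bigID (fun j => j \in f @: P))/= lerDl.
by rewrite sumr_ge0.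
Qed.

End RealInequalities.

Section RenyiSum.
Context {R : realType}.
Implicit Types (T S : finType) (a e : R).

(* The exponential moment of the Renyi divergence:
   [D_a(p||q) = ln (renyi_sum a p q) / (a - 1)]. *)
Definition renyi_sum T a (p q : T -> R) : R := \sum_t q t * (p t / q t) `^ a.

(** The tangent bound at the ratio [c] of the two totals, weighted by [q] and summed. The families
    are unnormalized, so that it applies to joint weights with the final output held fixed. *)
Lemma renyi_sum_jensen T a (p q : T -> R) : 1 < a ->
  (forall t, 0 < p t) -> (forall t, 0 < q t) ->
  (\sum_t q t) * ((\sum_t p t) / (\sum_t q t)) `^ a <= renyi_sum a p q.
Proof.
move=> a1 p0 q0; case: (pickP (@predT T)) => [t0 _|T0]; last first.
  by rewrite /renyi_sum !big_pred0// mul0r.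
have P0 : 0 < \sum_t p t.
  by rewrite (bigD1 t0)//= ltr_wpDr// sumr_ge0// => *; exact: ltW.
have Q0 : 0 < \sum_t q t.
  by rewrite (bigD1 t0)//= ltr_wpDr// sumr_ge0// => *; exact: ltW.
set c := (\sum_t p t) / _; have c0 : 0 < c by rewrite divr_gt0.
have ca : 0 < c `^ a by rewrite powR_gt0.
have pc : \sum_t p t = c * \sum_t q t by rewrite /c divfK// gt_eqF.
clearbody c.
apply: (@le_trans _ _ (\sum_t q t * (c `^ a * (a * (p t / q t / c) - (a - 1))))).
  rewrite [leRHS](eq_bigr (fun t => (c `^ a * a / c) * p t - c `^ a * (a - 1) * q t)).
    rewrite sumrB -!mulr_sumr.
    rewrite pc le_eqVlt; apply/orP; left; apply/eqP.
    by field; rewrite gt_eqF.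
  by move=> t _; field; rewrite !gt_eqF.
rewrite ler_sum// => t _; rewrite ler_pM2l//.
have u0 : 0 <= p t / q t / c by rewrite !divr_ge0// ltW.
have -> : (p t / q t) `^ a = c `^ a * (p t / q t / c) `^ a.
  by rewrite -powRM ?(ltW c0)// [c * _]mulrC divfK// gt_eqF.
by rewrite ler_pM2l//; have := bernoulli_powR u0 a1; lra.
Qed.

(* If [a * e] is small, expand [(p t / q t) `^ (a - 1)] to second order: the
   linear term is controlled by the chi-squared divergence, at most
   [4 * e ^+ 2]. *)
Lemma renyi_sum_pure T a e (p q : T -> R) : 1 < a -> 0 <= e ->
  (forall t, 0 < p t) -> (forall t, 0 < q t) ->
  \sum_t p t = 1 -> \sum_t q t = 1 ->
  (forall t, p t <= expR e * q t) -> (forall t, q t <= expR e * p t) ->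
  renyi_sum a p q <= expR (4 * e ^+ 2 * a * (a - 1)).
Proof.
move=> a1 e0 p0 q0 sp sq pq qp.
pose r t := p t / q t.
have r0 t : 0 < r t by rewrite divr_gt0.
have rle t : r t <= expR e by rewrite ler_pdivrMr.
have rge t : expR (- e) <= r t.
  by rewrite expRN ler_pdivlMr// mulrC ler_pdivrMr ?expR_gt0// mulrC.
have lr t : - e <= ln (r t) <= e.
  by rewrite -(ler_expR (- e)) -(ler_expR _ e) lnK ?posrE// rge rle.
have RE : renyi_sum a p q = \sum_t p t * expR ((a - 1) * ln (r t)).
  apply: eq_bigr => t _; rewrite -/(r t) /powR (gt_eqF (r0 t)).
  have -> : a * ln (r t) = (a - 1) * ln (r t) + ln (r t) by ring.
  rewrite expRD lnK ?posrE// mulrCA mulrC; congr (_ * _).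
  by rewrite mulrC divfK// gt_eqF.
(* For large [a * e] the crude bound [ln (r t) <= e] suffices, since then
   [(a - 1) * e <= 4 * e ^+ 2 * a * (a - 1)]. *)
rewrite RE; have [ae|ae] := lerP (1 / 2) (a * e).
  apply: (@le_trans _ _ (\sum_t p t * expR ((a - 1) * e))).
    rewrite ler_sum// => t _; rewrite ler_pM2l// ler_expR ler_pM2l; last lra.
    by have /andP[] := lr t.
  rewrite -mulr_suml sp mul1r ler_expR.
  have -> : 4 * e ^+ 2 * a * (a - 1) = (a - 1) * (e * (4 * (a * e))) by ring.
  by apply: ler_wpM2l; [lra|rewrite ler_peMr//; lra].
have e2 : e < 1 / 2 by apply: le_lt_trans ae; rewrite ler_peMl// ltW.
have ee : expR e <= 1 + 2 * e.
  have := @expR_le1DxD2sqr R e (ltW e2); rewrite expr2.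
  have : e * e <= e * (1 / 2) by rewrite ler_wpM2l// ltW.
  lra.
have r1 t : (r t - 1) ^+ 2 <= 4 * e ^+ 2.
  have l1 : 0 <= 2 * e - (r t - 1) by have := rle t; lra.
  have l2 : 0 <= 2 * e + (r t - 1).
    by have := rge t; have := @expR_ge1Dx R (- e); lra.
  by rewrite -subr_ge0; have := mulr_ge0 l1 l2; nra.
have p_r t : p t = q t * r t by rewrite mulrC divfK// gt_eqF.
have s0 : 0 < a - 1 by lra.
apply: (@le_trans _ _
    (\sum_t p t * (1 + (a - 1) * (r t - 1) + 2 * ((a - 1) * e) ^+ 2))).
  rewrite ler_sum// => t _; rewrite ler_pM2l//.
  have /andP[l1 l2] := lr t.
  have lnr : ln (r t) <= r t - 1.
    have -> : ln (r t) = ln (1 + (r t - 1)) by congr ln; ring.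
    by apply: le_ln1Dx; have := r0 t; lra.
  have sl : (a - 1) * ln (r t) <= (a - 1) * e by rewrite ler_pM2l.
  have sl' : (a - 1) * - e <= (a - 1) * ln (r t) by rewrite ler_pM2l.
  have v2 : (a - 1) * ln (r t) <= 1 / 2 by lra.
  apply: (le_trans (expR_le1DxD2sqr v2)); apply: lerD.
    by rewrite lerD2l ler_pM2l.
  rewrite ler_pM2l// -subr_ge0 subr_sqr mulr_ge0//; lra.
(* As [p t = q t * r t] and both families sum to 1, the linear term becomes the chi-squared
   divergence. *)
have -> : \sum_t p t * (1 + (a - 1) * (r t - 1) + 2 * ((a - 1) * e) ^+ 2) =
    1 + (a - 1) * (\sum_t q t * (r t - 1) ^+ 2) + 2 * ((a - 1) * e) ^+ 2.
  rewrite (eq_bigr (fun t => (1 - (a - 1) + 2 * ((a - 1) * e) ^+ 2) * p t +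
      ((a - 1) * (q t * (r t - 1) ^+ 2) + (a - 1) * (2 * p t - q t)))).
    rewrite !big_split/= -!mulr_sumr sumrB -mulr_sumr sp sq.
    by ring.
  by move=> t _; rewrite p_r; ring.
have S4 : \sum_t q t * (r t - 1) ^+ 2 <= 4 * e ^+ 2.
  rewrite -[leRHS]mul1r -[X in _ <= X * _]sq mulr_suml ler_sum// => t _.
  by rewrite ler_pM2l.
apply: le_trans (expR_ge1Dx _); rewrite -addrA lerD2l.
apply: (@le_trans _ _ ((a - 1) * (4 * e ^+ 2) + 2 * ((a - 1) * e) ^+ 2)).
  by rewrite lerD2r ler_pM2l.
rewrite -subr_ge0.
have -> : 4 * e ^+ 2 * a * (a - 1) - ((a - 1) * (4 * e ^+ 2) + 2 * ((a - 1) * e) ^+ 2)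
  = 2 * ((a - 1) * e) ^+ 2 by ring.
by rewrite mulr_ge0// sqr_ge0.
Qed.

Lemma renyi_sum_prod (J T : finType) a (p q : J -> T -> R) :
  (forall j t, 0 < p j t) -> (forall j t, 0 < q j t) ->
  renyi_sum a (fun w : {ffun J -> T} => \prod_j p j (w j))
              (fun w => \prod_j q j (w j)) =
  \prod_j renyi_sum a (p j) (q j).
Proof.
move=> p0 q0; rewrite /renyi_sum bigA_distr_bigA; apply: eq_bigr => w _.
rewrite -prodf_div [RHS]big_split/=; congr (_ * _).
by rewrite powR_prod// => j; rewrite divr_ge0// ltW.
Qed.

(** Adaptive composition with the intermediate [w] forgotten: Jensen at each output [t] passes to
    the joint law, whose moment factors once [t] is summed first. *)
Lemma renyi_sum_mix (W T : finType) a (e1 e2 : R) (c c' : W -> R)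
    (f f' : W -> T -> R) : 1 < a -> 0 <= e2 ->
  (forall w, 0 < c w) -> (forall w, 0 < c' w) ->
  (forall w t, 0 < f w t) -> (forall w t, 0 < f' w t) ->
  renyi_sum a c c' <= e1 ->
  (forall w, renyi_sum a (f w) (f' w) <= e2) ->
  renyi_sum a (fun t => \sum_w c w * f w t) (fun t => \sum_w c' w * f' w t)
    <= e1 * e2.
Proof.
move=> a1 e20 c0 c'0 f0 f'0 h1 h2.
apply: (@le_trans _ _ (\sum_t \sum_w
    (c' w * f' w t) * ((c w * f w t) / (c' w * f' w t)) `^ a)).
  by rewrite ler_sum// => t _; apply: renyi_sum_jensen => // w; rewrite mulr_gt0.
rewrite exchange_big/=.
rewrite (eq_bigr (fun w => c' w * (c w / c' w) `^ a * renyi_sum a (f w) (f' w))).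
  apply: (@le_trans _ _ (renyi_sum a c c' * e2)).
    rewrite mulr_suml ler_sum// => w _; apply: ler_wpM2l => //.
    by rewrite mulr_ge0 ?powR_ge0// ltW.
  by rewrite ler_wpM2r.
move=> w _; rewrite mulr_sumr; apply: eq_bigr => t _.
have cc : 0 <= c w / c' w by rewrite divr_ge0 ?ltW.
have ff : 0 <= f w t / f' w t by rewrite divr_ge0 ?ltW.
by rewrite -mulf_div (powRM a cc ff) mulrACA.
Qed.

End RenyiSum.

(** * The exponential mechanism on a finite set *)

Section Softmax.
Context {R : realType}.
Implicit Types T : finType.

Definition softmax T (u : T -> R) (t : T) : R := expR (u t) / \sum_s expR (u s).

Lemma softmax_norm_gt0 T (u : T -> R) (t : T) : 0 < \sum_s expR (u s).
Proof.
by rewrite (bigD1 t)//= ltr_wpDr ?expR_gt0// sumr_ge0// => *; exact: expR_ge0.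
Qed.

Lemma softmax_gt0 T (u : T -> R) t : 0 < softmax u t.
Proof. by rewrite divr_gt0 ?expR_gt0// softmax_norm_gt0. Qed.

Lemma sum_softmax T (u : T -> R) (t : T) : \sum_t softmax u t = 1.
Proof. by rewrite -mulr_suml divff// gt_eqF// (softmax_norm_gt0 u t). Qed.

(** One factor [expR d] comes from the weight of [t], the other from the normalizing sum. *)
Lemma softmax_pure T (u v : T -> R) (d : R) : (forall t, `|u t - v t| <= d) ->
  forall t, softmax u t <= expR (2 * d) * softmax v t.
Proof.
move=> uv t; rewrite /softmax mulrA.
have vn := softmax_norm_gt0 v t; have un := softmax_norm_gt0 u t.
have ut : expR (u t) <= expR d * expR (v t).
  by rewrite -expRD ler_expR; have := uv t; rewrite ler_norml; lra.
have Zv : \sum_s expR (v s) <= expR d * \sum_s expR (u s).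
  rewrite mulr_sumr ler_sum// => s _; rewrite -expRD ler_expR.
  by have := uv s; rewrite ler_norml; lra.
rewrite ler_pdivrMr// mulrAC ler_pdivlMr//.
have -> : 2 * d = d + d by ring.
apply: (le_trans (ler_pM (expR_ge0 _) (ltW vn) ut Zv)).
by rewrite expRD le_eqVlt; apply/orP; left; apply/eqP; ring.
Qed.

Lemma softmax_le T (u : T -> R) (s t : T) (g : R) :
  u t <= u s - g -> softmax u t <= expR (- g).
Proof.
move=> ut; rewrite /softmax ler_pdivrMr ?(softmax_norm_gt0 u t)//.
apply: (@le_trans _ _ (expR (- g) * expR (u s))).
  by rewrite -expRD ler_expR addrC.
by rewrite ler_pM2l ?expR_gt0// (bigD1 s)//= lerDl sumr_ge0// => *; exact: expR_ge0.
Qed.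

Definition grid_pt (x0 s : R) (g : nat) : R := x0 + s * g%:R.

(* Moving one grid step towards [h] multiplies the weight by [expR (lam * s)],
   hence the points at distance at least [s] on one side of [h] carry at most a
   fraction [expR (- (lam * s))] of the total mass, however many they are. *)
Lemma softmax_grid_tail (L : nat) (x0 s lam h : R) :
  0 < s -> 0 <= lam -> x0 <= h <= x0 + s * L%:R ->
  \sum_(g < L.+1 | s <= `|h - grid_pt x0 s g|)
    softmax (fun g : 'I_L.+1 => - (lam * `|h - grid_pt x0 s g|)) g <=
  2 * expR (- (lam * s)).
Proof.
move=> s0 lam0 /andP[h0 hL].
pose pt (g : 'I_L.+1) := grid_pt x0 s g.
set w := (fun g : 'I_L.+1 => - _).
have pt_le g : pt g <= h -> w g = - (lam * (h - pt g)).
  by move=> gh; rewrite /w ger0_norm// subr_ge0.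
have pt_ge g : h <= pt g -> w g = - (lam * (pt g - h)).
  by move=> gh; rewrite /w distrC ger0_norm// subr_ge0.
have Z0 : 0 < \sum_g expR (w g) by exact: softmax_norm_gt0 ord0.
rewrite -mulr_suml ler_pdivrMr// -mulrA.
(* [up] is a true shift only below [L] and [dn] only above 0; [lt_L] and [pos] ensure this because
   [h] lies within the grid. *)
pose up (g : 'I_L.+1) : 'I_L.+1 := inord g.+1.
pose dn (g : 'I_L.+1) : 'I_L.+1 := inord g.-1.
have ptS (g : 'I_L.+1) : (g < L)%N -> pt (up g) = pt g + s.
  by move=> gL; rewrite /pt /grid_pt inordK ?ltnS// -natr1; ring.
have ptP (g : 'I_L.+1) : (0 < g)%N -> pt (dn g) = pt g - s.
  move=> gL; rewrite /pt /grid_pt inordK; last by rewrite prednK// ltnW.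
  by rewrite -{2}(prednK gL) -natr1; ring.
have ptI : injective pt.
  move=> g g' /addrI /(mulfI (lt0r_neq0 s0)) /eqP; rewrite eqr_nat => /eqP.
  exact: val_inj.
have hi : \sum_(g | h <= pt g - s) expR (w g) <=
    expR (- (lam * s)) * \sum_g expR (w g).
  have pos (g : 'I_L.+1) : h <= pt g - s -> (0 < g)%N.
    by rewrite lt0n; apply: contraTneq => g0; rewrite /pt /grid_pt g0 mulr0 -ltNge; lra.
  rewrite (eq_bigr (fun g => expR (- (lam * s)) * expR (w (dn g)))); last first.
    move=> g hg; rewrite -expRD; congr expR.
    rewrite !pt_ge ?ptP ?pos//; last by lra.
    by ring.
  rewrite -mulr_sumr ler_pM2l ?expR_gt0//.
  apply: (@ler_sum_inj _ _ _ dn (fun g => h <= pt g - s) (fun g => expR (w g))).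
    by move=> g g' /pos g0 /pos g'0 /(congr1 pt); rewrite !ptP// => /addIr/ptI.
  by move=> g; exact: expR_ge0.
have lo : \sum_(g | pt g + s <= h) expR (w g) <=
    expR (- (lam * s)) * \sum_g expR (w g).
  have lt_L (g : 'I_L.+1) : pt g + s <= h -> (g < L)%N.
    rewrite ltnNge; apply: contraTN => Lg; rewrite -ltNge.
    suff : s * L%:R <= s * g%:R by rewrite /pt /grid_pt; lra.
    by rewrite ler_pM2l// ler_nat.
  rewrite (eq_bigr (fun g => expR (- (lam * s)) * expR (w (up g)))); last first.
    move=> g hg; rewrite -expRD; congr expR.
    rewrite !pt_le ?ptS ?lt_L//; last by lra.
    by ring.
  rewrite -mulr_sumr ler_pM2l ?expR_gt0//.
  apply: (@ler_sum_inj _ _ _ up (fun g => pt g + s <= h) (fun g => expR (w g))).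
    by move=> g g' /lt_L g0 /lt_L g'0 /(congr1 pt); rewrite !ptS// => /addIr/ptI.
  by move=> g; exact: expR_ge0.
have -> : forall z : R, 2 * z = z + z by move=> z; ring.
apply: le_trans (lerD hi lo).
rewrite [leLHS]big_mkcond [X in _ <= X + _]big_mkcond [X in _ <= _ + X]big_mkcond.
rewrite -big_split/= ler_sum// => g _.
have := expR_ge0 (w g) => ex0.
have [hg|hg] := lerP (pt g) h.
  case: ifP => hs; last by do 2 case: ifP => _; lra.
  have -> : pt g + s <= h by lra.
  by case: ifP => _; lra.
case: ifP => hs; last by do 2 case: ifP => _; lra.
have -> : h <= pt g - s by lra.
by case: ifP => _; lra.
Qed.

End Softmax.

(** * Coarse localization *)

Section Encoded.
Context {R : realType}.
Variables (n : nat) (X : finType).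
Implicit Types e : {ffun 'I_n -> X}.

(** At most one position rather than exactly one: rounding may merge neighboring datasets. *)
Definition differ1 e e' : Prop := exists i, forall j, j != i -> e j = e' j.

Lemma differ1_sym e e' : differ1 e e' -> differ1 e' e.
Proof. by move=> [i h]; exists i => j /h. Qed.

Lemma ler_dist_sum1 (f : X -> R) e e' (d : R) : differ1 e e' ->
  (forall x y, `|f x - f y| <= d) ->
  `|\sum_i f (e i) - \sum_i f (e' i)| <= d.
Proof.
move=> [i h] fd; rewrite (bigD1 i)//= [in X in _ - X](bigD1 i)//=.
rewrite (eq_bigr (fun j => f (e' j))); last by move=> j /h ->.
by rewrite opprD addrACA subrr addr0.
Qed.

(** Markov's inequality for the exponential of [theta] times the sum, whose moment under a product
    law factors. *)
Lemma chernoff_iid (p f : X -> R) (theta a C : R) :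
  0 <= theta -> (forall x, 0 <= p x) ->
  \sum_x p x * expR (theta * f x) <= expR C ->
  \sum_(e : {ffun 'I_n -> X} | n%:R * a <= \sum_i f (e i)) \prod_i p (e i) <=
  expR (n%:R * (C - theta * a)).
Proof.
move=> th0 p0 hC.
apply: (@le_trans _ _ (\sum_(e : {ffun 'I_n -> X})
    (\prod_i (p (e i) * expR (theta * f (e i)))) *
    expR (- (n%:R * (theta * a))))).
  rewrite big_mkcond ler_sum// => e _.
  have P0 : 0 <= \prod_i p (e i) by rewrite prodr_ge0.
  case: ifPn => [h|_]; last first.
    rewrite mulr_ge0 ?expR_ge0// prodr_ge0// => i _.
    by rewrite mulr_ge0 ?expR_ge0.
  rewrite big_split/= -mulrA ler_peMr// -expR_sum -expRD.
  by rewrite -[leLHS]expR0 ler_expR -mulr_sumr mulrCA -mulrBr mulr_ge0// subr_ge0 h.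
rewrite -mulr_suml -(bigA_distr_bigA (fun _ x => p x * expR (theta * f x))).
rewrite mulrBr expRD ler_pM2r ?expR_gt0// expRM_natl.
rewrite prodr_const card_ord lerXn2r ?nnegrE ?expR_ge0// sumr_ge0// => x _.
by rewrite mulr_ge0 ?expR_ge0.
Qed.

End Encoded.

(** * Codes with small pairwise agreement *)

Section Codes.
Local Open Scope nat_scope.
Variables (A : finType) (m : nat).
Implicit Types u v : {ffun 'I_m -> A}.

Definition agree u v : nat := \sum_j (u j == v j).

Lemma agreeC u v : agree u v = agree v u.
Proof. by apply: eq_bigr => j _; rewrite eq_sym. Qed.

(** Markov's inequality for [#|A| ^ agree u v]: its sum over [v] factors, each coordinate
    contributing at most [2 * #|A|]. *)
Lemma card_agree_ge (t : nat) u : 0 < #|A| ->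
  #|[pred v | t <= agree u v]| * #|A| ^ t <= (2 * #|A|) ^ m.
Proof.
move=> A0.
have -> : #|[pred v | t <= agree u v]| * #|A| ^ t =
    \sum_(v | t <= agree u v) #|A| ^ t by rewrite sum_nat_const.
apply: (@leq_trans (\sum_v #|A| ^ agree u v)).
  rewrite big_mkcond leq_sum// => v _; case: ifP => // h.
  by rewrite leq_pexp2l.
rewrite (eq_bigr (fun v => \prod_j #|A| ^ (u j == v j))); last first.
  by move=> v _; rewrite /agree expn_sum.
rewrite -(bigA_distr_bigA (fun j a => #|A| ^ (u j == a))).
rewrite -[X in _ ^ X]card_ord -prod_nat_const leq_prod// => j _.
rewrite (bigD1 (u j))//= eqxx expn1 mul2n -addnn leq_add2l.
rewrite (eq_bigr (fun=> 1)); last by move=> a /negPf au; rewrite eq_sym au.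
by rewrite sum_nat_const muln1 max_card.
Qed.

End Codes.

(* Greedy (Gilbert-Varshamov) construction. *)
Lemma code_exists (A : finType) (m K : nat) : #|A| = (2 ^ 9)%N ->
  (K <= 2 ^ m)%N ->
  exists c : nat -> {ffun 'I_(8 * m) -> A},
    forall i j, (i < j < K)%N -> (agree (c i) (c j) < m)%N.
Proof.
move=> cA; have A0 : (0 < #|A|)%N by rewrite cA expn_gt0.
have [a0 _] : exists a : A, a \in A by apply/card_gt0P.
elim: K => [_|K IH KL]; first by exists (fun=> [ffun=> a0]) => i j; rewrite andbC.
have [c hc] := IH (ltnW KL).
pose bad := \bigcup_(i < K) [set v | (m <= agree (c i) v)%N].
have hV : (#|bad| < #|{ffun 'I_(8 * m) -> A}|)%N.
  rewrite card_ffun card_ord.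
  apply: (@leq_ltn_trans (\sum_(i < K) #|[set v | (m <= agree (c i) v)%N]|)).
    rewrite /bad; elim/big_rec2 : _ => [|i x y _ h]; first by rewrite cards0.
    by apply: leq_trans (leq_card_setU _ _) _; rewrite leq_add2l.
  (* With [2 ^ 9] letters and length [8 * m], each forbidden ball holds at most a [2 ^ m]-th of all
     words, and only [K < 2 ^ m] balls are excluded. *)
  have VA (i : 'I_K) :
      (#|[set v | (m <= agree (c i) v)%N]| * 2 ^ m <= #|A| ^ (8 * m))%N.
    have := card_agree_ge m (c i) A0.
    have -> : #|[pred v | (m <= agree (c i) v)%N]| =
        #|[set v | (m <= agree (c i) v)%N]|.
      by apply: eq_card => v; rewrite !inE.
    have -> : (#|A| ^ m = 2 ^ (8 * m) * 2 ^ m)%N.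
      by rewrite cA -expnM -expnD; congr (2 ^ _)%N; lia.
    by rewrite expnMn mulnCA leq_pmul2l ?expn_gt0.
  rewrite -(ltn_pmul2r (_ : 0 < 2 ^ m)%N) ?expn_gt0// big_distrl/=.
  apply: (@leq_ltn_trans (\sum_(i < K) #|A| ^ (8 * m))).
    by apply: leq_sum => i _; exact: VA.
  by rewrite sum_nat_const card_ord mulnC ltn_pmul2l// expn_gt0 A0.
have /card_gt0P[v] : (0 < #|~: bad|)%N.
  by rewrite -(ltn_add2l #|bad|) addn0 cardsC.
rewrite inE => vbad.
exists (fun i => if i == K then v else c i) => i j /andP[ij].
rewrite ltnS leq_eqVlt => /predU1P[jK|jK].
  rewrite jK eqxx ltn_eqF -?jK//; rewrite ltnNge; apply: contra vbad => h.
  have iK : (i < K)%N by rewrite -jK.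
  by apply/bigcupP; exists (Ordinal iK); rewrite ?inE.
by rewrite !ltn_eqF ?(ltn_trans ij)// hc// ij.
Qed.

(** * Privacy and accuracy of the coordinatewise vote on codewords *)

Section CodeMechanism.
Context {R : realType}.
Variables (n K m : nat) (X A : finType) (eta : R).
Variables (c : 'I_K.+1 -> {ffun 'I_(8 * m) -> A}) (lab : X -> 'I_K.+1).
Implicit Types (e : {ffun 'I_n -> X}) (w : {ffun 'I_(8 * m) -> A}).

Definition votes e (j : 'I_(8 * m)) (a : A) : R :=
  \sum_i (c (lab (e i)) j == a)%:R.

Definition code_law e w : R :=
  \prod_j softmax (fun a => eta * votes e j a) (w j).

Definition decode w : 'I_K.+1 := [arg max_(b > ord0) agree w (c b)]%N.

Lemma code_law_gt0 e w : 0 < code_law e w.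
Proof. by apply: prodr_gt0 => j _; exact: softmax_gt0. Qed.

Lemma sum_code_law e : A -> \sum_w code_law e w = 1.
Proof.
move=> a0.
rewrite -(bigA_distr_bigA (fun j a => softmax (fun a => eta * votes e j a) a)).
by apply: big1 => j _; exact: sum_softmax.
Qed.

(** Each vote is [2 * eta]-pure, so the [8 * m] independent coordinates cost [8 * m] times
    [4 * (2 * eta) ^+ 2]. *)
Lemma code_law_renyi e e' (a : R) : A -> 0 <= eta -> 1 < a -> differ1 e e' ->
  renyi_sum a (code_law e) (code_law e') <=
  expR (128 * eta ^+ 2 * m%:R * a * (a - 1)).
Proof.
move=> a0 eta0 a1 ee'.
rewrite (@renyi_sum_prod _ _ _ _
  (fun j => softmax (fun a => eta * votes e j a))
  (fun j => softmax (fun a => eta * votes e' j a)));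
  [|by move=> *; exact: softmax_gt0..].
apply: (@le_trans _ _
    (\prod_(j < 8 * m) expR (4 * (2 * eta) ^+ 2 * a * (a - 1)))).
  have close f f' j b : differ1 f f' ->
      `|eta * votes f j b - eta * votes f' j b| <= eta.
    move=> ff'; rewrite -mulrBr normrM ger0_norm// ler_piMr//.
    apply: (@ler_dist_sum1 _ _ _ (fun x => (c (lab x) j == b)%:R) _ _ _ ff').
    by move=> x y; do 2 case: eqP => _;
      rewrite ?subrr ?subr0 ?sub0r ?normrN ?normr0 ?normr1.
  apply: ler_prod => j _; apply/andP; split.
    rewrite /renyi_sum sumr_ge0// => b _.
    by rewrite mulr_ge0 ?powR_ge0// ltW// softmax_gt0.
  apply: renyi_sum_pure => //;
    [by rewrite mulr_ge0|by move=> *; exact: softmax_gt0..| | | |].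
  - exact: sum_softmax.
  - exact: sum_softmax.
  - by apply: softmax_pure => b; exact: close.
  - by apply: softmax_pure => b; apply: close; exact: differ1_sym.
rewrite prodr_const card_ord -expRM_natl ler_expR natrM le_eqVlt.
by apply/orP; left; apply/eqP; ring.
Qed.

Hypothesis distc : forall b b', b != b' -> (agree (c b) (c b') < m)%N.

Definition errors b1 b2 w : nat :=
  \sum_j ((w j != c b1 j) && (w j != c b2 j)).

(** Fewer than [m] coordinates of [w] miss both codewords, so the decoded one agrees with [w] in
    more than [7 * m / 2] places; a third codeword would agree in fewer than [3 * m]. *)
Lemma decode_near b1 b2 w : (errors b1 b2 w < m)%N -> decode w \in [:: b1; b2].
Proof.
move=> hw; apply/negPn/negP; rewrite !inE negb_or => /andP[d1 d2].
have [max1 max2] : (agree w (c b1) <= agree w (c (decode w)))%N /\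
    (agree w (c b2) <= agree w (c (decode w)))%N.
  by rewrite /decode; case: arg_maxnP => // b _ hb; split; exact: hb.
have tot : (8 * m <= agree w (c b1) + agree w (c b2) + errors b1 b2 w)%N.
  rewrite -[leqLHS]card_ord -sum1_card -!big_split/= leq_sum// => j _.
  by do 2 case: eqP.
have up : (agree w (c (decode w)) <= agree (c (decode w)) (c b1) +
    agree (c (decode w)) (c b2) + errors b1 b2 w)%N.
  rewrite -!big_split/= leq_sum// => j _.
  case: (w j =P _) => // ->.
  by do 2 case: eqP.
by have := distc d1; have := distc d2; lia.
Qed.

(** Markov's inequality for [B] to the number of errors: each coordinate has moment at most 2, and
    [2 ^+ (8 * m) / B ^+ m] is [(256 / B) ^+ m]. *)
Lemma code_law_far e b1 b2 (B : R) : A -> 0 <= eta -> (0 < m)%N -> 256 <= B ->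
  4 * \sum_i (lab (e i) \notin [:: b1; b2])%:R <= n%:R :> R ->
  #|A|%:R * expR (- (eta * n%:R / 8)) <= B^-1 ->
  \sum_(w | decode w \notin [:: b1; b2]) code_law e w <= 256 / B.
Proof.
move=> a0 eta0 m0 B256 few hB.
have B0 : 0 < B by lra.
have B1 : 1 <= B by lra.
pose far j (a : A) := (a != c b1 j) && (a != c b2 j).
pose sm j := softmax (fun a => eta * votes e j a).
(* A wrong symbol gets at most [n / 4] votes while the more popular correct symbol gets at least
   [3 * n / 8]: a lead of [n / 8]. *)
have far_small j a : far j a -> sm j a <= expR (- (eta * n%:R / 8)).
  move=> /andP[ac1 ac2].
  have va : votes e j a <= n%:R / 4.
    suff : votes e j a <= \sum_i (lab (e i) \notin [:: b1; b2])%:R.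
      by move: few; lra.
    rewrite ler_sum// => i _; rewrite !inE negb_or.
    case: eqP => [cj|_]; last by rewrite ler0n.
    have -> : lab (e i) != b1 by apply: contraNneq ac1 => <-; rewrite cj.
    have -> : lab (e i) != b2 by apply: contraNneq ac2 => <-; rewrite cj.
    by [].
  have v12 : 3 * (n%:R / 4) <= votes e j (c b1 j) + votes e j (c b2 j).
    suff : n%:R <= votes e j (c b1 j) + votes e j (c b2 j) +
        \sum_i (lab (e i) \notin [:: b1; b2])%:R by move: few; lra.
    have -> : n%:R = \sum_(i < n) 1 :> R by rewrite sumr_const card_ord.
    rewrite -!big_split/= ler_sum// => i _; rewrite !inE.
    case: (lab (e i) =P b1) => [->|_]; first by rewrite eqxx -addrA lerDl addr_ge0.
    case: (lab (e i) =P b2) => [->|_]; first by rewrite eqxx addrAC lerDr addr_ge0.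
    by rewrite lerDr addr_ge0.
  have [v1|v1] := lerP (3 * (n%:R / 8)) (votes e j (c b1 j)).
    apply: (@softmax_le _ _ _ (c b1 j)); rewrite -mulrA -mulrBr.
    by apply: ler_wpM2l => //; lra.
  apply: (@softmax_le _ _ _ (c b2 j)); rewrite -mulrA -mulrBr.
  by apply: ler_wpM2l => //; lra.
have Bn0 : 0 < B ^+ m by rewrite exprn_gt0.
apply: (@le_trans _ _
   ((\sum_(w : {ffun 'I_(8 * m) -> A})
       \prod_j (sm j (w j) * B ^+ far j (w j))) / B ^+ m)).
  rewrite mulr_suml big_mkcond ler_sum// => w _.
  have sm0 : 0 < \prod_j sm j (w j) by exact: code_law_gt0.
  rewrite big_split/= -/(code_law e w) -expr_sum.
  case: ifPn => [dw|_]; last first.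
    by rewrite !mulr_ge0 ?invr_ge0 ?exprn_ge0 ?(ltW B0)// ltW// code_law_gt0.
  rewrite -mulrA ler_peMr ?(ltW sm0)// ler_pdivlMr// mul1r.
  rewrite ler_weXn2l//; apply: contraNT dw; rewrite -ltnNge; exact: decode_near.
rewrite -(bigA_distr_bigA (fun j a => sm j a * B ^+ far j a)).
have h2 j : 0 <= \sum_a sm j a * B ^+ far j a <= 2.
  apply/andP; split.
    rewrite sumr_ge0// => a _.
    by rewrite mulr_ge0 ?exprn_ge0 ?(ltW B0)// ltW// softmax_gt0.
  apply: (@le_trans _ _ (\sum_a (sm j a + B * expR (- (eta * n%:R / 8))))).
    rewrite ler_sum// => a _; case: (boolP (far j a)) => fa /=.
      rewrite expr1 mulrC; apply: (@le_trans _ _ (B * expR (- (eta * n%:R / 8)))).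
        by rewrite ler_pM2l// far_small.
      by rewrite lerDr ltW// softmax_gt0.
    by rewrite expr0 mulr1 lerDl mulr_ge0 ?expR_ge0// ltW.
  rewrite big_split/= sum_softmax// sumr_const -[_ *+ _]mulr_natl [_%:R * (B * _)]mulrCA.
  have : B * (#|A|%:R * expR (- (eta * n%:R / 8))) <= B * B^-1 by rewrite ler_pM2l.
  by rewrite divff ?gt_eqF//; lra.
apply: (@le_trans _ _ (2 ^+ (8 * m) / B ^+ m)).
  rewrite ler_pM2r ?invr_gt0//.
  apply: (@le_trans _ _ (\prod_(j < 8 * m) 2)); first exact: ler_prod.
  by rewrite prodr_const card_ord.
rewrite exprM -expr_div_n.
have -> : 2 ^+ 8 = 256 :> R by rewrite -natrX.
have : 0 <= 256 / B by rewrite divr_ge0// ltW.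
have : 256 / B <= 1 by rewrite ler_pdivrMr// mul1r.
move: (256 / B) => x x1 x0; rewrite -(prednK m0) exprS ler_piMr//.
exact: exprn_ile1.
Qed.

End CodeMechanism.

(** * The stable histogram *)

Section StableHistogram.
Context {R : realType}.
Variables (n K : nat) (X : finType) (eta delta : R) (lab : X -> 'I_K.+1).
Hypotheses (eta0 : 0 <= eta) (delta0 : 0 < delta) (delta1 : delta <= 1).
Implicit Types (e : {ffun 'I_n -> X}) (b : 'I_K.+1).

Definition bin_count e b : R := \sum_i (lab (e i) == b)%:R.

(** Subtracting 1 makes the weight vanish continuously at the threshold [n / 4], so that a count
    crossing it changes the weight only a little. *)
Definition excess (x : R) : R := Num.max (expR (eta * (x - n%:R / 4)) - 1) 0.

(* The bin [0] also plays the role of the failure symbol of the stable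
   histogram: the extra weight makes newly appearing bins [delta]-rare. *)
Definition bin_weight e b : R :=
  excess (bin_count e b) + (b == ord0)%:R * (expR eta / delta).

Definition stable_law e b : R := bin_weight e b / \sum_b' bin_weight e b'.

Let W : R := expR eta / delta.

Let eta1 : 1 <= expR eta. Proof. by rewrite -[leLHS]expR0 ler_expR. Qed.

Let W_ge : expR eta - 1 <= delta * W.
Proof. by rewrite /W mulrC divfK ?gt_eqF//; lra. Qed.

Let W1 : 1 <= W.
Proof. by rewrite /W ler_pdivlMr// mul1r; have := eta1; have := delta1; lra. Qed.

Lemma excess_ge0 x : 0 <= excess x.
Proof. by rewrite /excess le_max lexx orbT. Qed.

(** The uncut exponential is at most [excess y + 1]; the 1 turns into the additive term, paid only
    by a bin that gains a sample. *)
Lemma excessD x y (z : bool) : x <= y + z%:R ->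
  excess x <= expR eta * excess y + (expR eta - 1) * z%:R.
Proof.
move=> xy; rewrite /excess ge_max; apply/andP; split; last first.
  by rewrite addr_ge0// mulr_ge0 ?expR_ge0 ?excess_ge0// subr_ge0.
have h1 : expR (eta * (x - n%:R / 4)) <=
    expR (eta * (y - n%:R / 4)) * expR (eta * z%:R).
  rewrite -expRD ler_expR -mulrDr ler_wpM2l//; lra.
have h2 : expR (eta * (y - n%:R / 4)) <= excess y + 1.
  by rewrite -lerBlDr /excess le_max lexx.
have := excess_ge0 y => ey0.
case: z xy h1 => /= _ h1; move: h1; rewrite ?mulr1 ?mulr0 ?expR0 ?mulr1 => h1.
  have : expR (eta * (y - n%:R / 4)) * expR eta <= (excess y + 1) * expR eta.
    by rewrite ler_pM2r// expR_gt0.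
  by rewrite -/(excess y); nra.
have : excess y <= expR eta * excess y by rewrite ler_peMl.
by rewrite -/(excess y); lra.
Qed.

Lemma bin_weight_ge0 e b : 0 <= bin_weight e b.
Proof.
by rewrite addr_ge0 ?excess_ge0// mulr_ge0// ltW// (lt_le_trans _ W1).
Qed.

Lemma sum_bin_weight_ge e b : W + excess (bin_count e b) <= \sum_b' bin_weight e b'.
Proof.
rewrite big_split/= -mulr_suml (bigD1 b)//=.
have -> : \sum_(i < K.+1) (i == ord0)%:R = 1 :> R.
  by rewrite (bigD1 ord0)//= big1 ?addr0// => i /negPf ->.
rewrite mul1r -/W [W + _]addrC lerD2r lerDl sumr_ge0// => *; exact: excess_ge0.
Qed.

Let Z_ge e : W <= \sum_b' bin_weight e b'.
Proof.
by apply: le_trans (sum_bin_weight_ge e ord0); rewrite lerDl excess_ge0.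
Qed.

Let Z_gt0 e : 0 < \sum_b' bin_weight e b'.
Proof. by have := Z_ge e; have := W1; lra. Qed.

Lemma stable_law_ge0 e b : 0 <= stable_law e b.
Proof. by rewrite divr_ge0 ?bin_weight_ge0// ltW// Z_gt0. Qed.

Lemma sum_stable_law e : \sum_b stable_law e b = 1.
Proof. by rewrite -mulr_suml divff// gt_eqF// Z_gt0. Qed.

Lemma bin_weight_differ1 e e' : differ1 e e' -> exists b0, forall b,
  bin_weight e b <= expR eta * bin_weight e' b + (expR eta - 1) * (b == b0)%:R.
Proof.
move=> [i h]; exists (lab (e i)) => b.
have : excess (bin_count e b) <= expR eta * excess (bin_count e' b) +
    (expR eta - 1) * (b == lab (e i))%:R.
  apply: excessD; rewrite /bin_count (bigD1 i)//= [in leRHS](bigD1 i)//=.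
  rewrite (eq_bigr (fun j => (lab (e' j) == b)%:R)); last by move=> j /h ->.
  by rewrite eq_sym [leRHS]addrC lerD2l lerDr.
rewrite /bin_weight -/W.
have : (b == ord0)%:R * W <= expR eta * ((b == ord0)%:R * W).
  by rewrite ler_peMl// mulr_ge0//; have := W1; lra.
lra.
Qed.

(** The normalizer is at least 1, so a second factor [expR eta] absorbs the additive term. *)
Lemma sum_bin_weight_differ1 e e' : differ1 e e' ->
  \sum_b bin_weight e b <= expR (2 * eta) * \sum_b bin_weight e' b.
Proof.
move=> /bin_weight_differ1[b0 hb].
apply: (@le_trans _ _ (expR eta * (\sum_b bin_weight e' b) + (expR eta - 1))).
  rewrite mulr_sumr.
  have -> : expR eta - 1 = \sum_b (expR eta - 1) * (b == b0)%:R.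
    by rewrite (bigD1 b0)//= eqxx mulr1 big1 ?addr0// => b /negPf ->; rewrite mulr0.
  by rewrite -big_split/= ler_sum.
have -> : expR (2 * eta) = expR eta * expR eta by rewrite -expRD; congr expR; ring.
have Z1 : 1 <= \sum_b bin_weight e' b := le_trans W1 (Z_ge e').
move: (\sum_b _) Z1 => Z Z1; rewrite -subr_ge0.
have -> : expR eta * expR eta * Z - (expR eta * Z + (expR eta - 1)) =
  (expR eta - 1) * (expR eta * Z - 1) by ring.
by rewrite mulr_ge0// subr_ge0// mulr_ege1.
Qed.

(** The weight costs [eta] and the normalizer [2 * eta]; the leftover mass [(expR eta - 1) / Z] is
    at most [delta] because [Z >= expR eta / delta]. The slack is a function [d] so that it can be
    mixed with the fine stage. *)
Lemma stable_law_dp e e' : differ1 e e' -> exists d : 'I_K.+1 -> R,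
  [/\ forall b, 0 <= d b, \sum_b d b <= delta &
      forall b, stable_law e b <= expR (3 * eta) * stable_law e' b + d b].
Proof.
move=> ee'; have [b0 hb] := bin_weight_differ1 ee'.
have hZ := sum_bin_weight_differ1 (differ1_sym ee').
set Z := \sum_b bin_weight e b in hZ *.
have Z0 : 0 < Z := Z_gt0 e.
exists (fun b => (expR eta - 1) * (b == b0)%:R / Z); split.
- by move=> b; rewrite divr_ge0 ?mulr_ge0 ?subr_ge0// ltW.
- rewrite (bigD1 b0)//= eqxx mulr1 big1 ?addr0; last first.
    by move=> b /negPf ->; rewrite mulr0 mul0r.
  rewrite ler_pdivrMr//; apply: (le_trans W_ge).
  by rewrite ler_pM2l// Z_ge.
- move=> b; rewrite /stable_law -/Z ler_pdivrMr// mulrDl divfK ?(gt_eqF Z0)//.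
  apply: (le_trans (hb b)); rewrite lerD2r.
  have -> : expR (3 * eta) = expR eta * expR (2 * eta).
    by rewrite -expRD; congr expR; ring.
  rewrite -!mulrA ler_pM2l ?expR_gt0// mulrCA ler_peMr ?bin_weight_ge0//.
  by rewrite mulrCA mulrC ler_pdivlMr ?Z_gt0// mul1r.
Qed.

(** Outside the two bins only bin 0 can have weight, namely [W], whereas some bin with at least
    [3 * n / 8] samples brings the normalizer to [expR (eta * n / 8)] or more. *)
Lemma stable_law_far e b1 b2 :
  4 * \sum_i (lab (e i) \notin [:: b1; b2])%:R <= n%:R :> R ->
  \sum_(b | b \notin [:: b1; b2]) stable_law e b <=
  expR (eta - eta * n%:R / 8) / delta.
Proof.
move=> few.
have small b : b \notin [:: b1; b2] -> excess (bin_count e b) = 0.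
  move=> hb; have cb : bin_count e b <= n%:R / 4.
    suff : bin_count e b <= \sum_i (lab (e i) \notin [:: b1; b2])%:R.
      by move: few; lra.
    by rewrite ler_sum// => i _; case: eqP => [->|_]; rewrite ?hb ?ler0n.
  apply/eqP; rewrite /excess -/(Order.max _ _) eq_le le_max lexx orbT andbT.
  rewrite ge_max lexx andbT subr_le0 -[leRHS]expR0 ler_expR.
  by apply: mulr_ge0_le0 => //; rewrite subr_le0.
have big : exists b, 3 * (n%:R / 8) <= bin_count e b.
  have c12 : 3 * (n%:R / 4) <= bin_count e b1 + bin_count e b2.
    suff : n%:R <= bin_count e b1 + bin_count e b2 +
        \sum_i (lab (e i) \notin [:: b1; b2])%:R by move: few; lra.
    have -> : n%:R = \sum_(i < n) 1 :> R by rewrite sumr_const card_ord.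
    rewrite -!big_split/= ler_sum// => i _; rewrite !inE.
    by do 2 case: eqP => _ /=; rewrite ?(addr0, add0r)// lerDl.
  have [v1|v1] := lerP (3 * (n%:R / 8)) (bin_count e b1); first by exists b1.
  by exists b2; lra.
have [b hb] := big.
have Zge : expR (eta * n%:R / 8) <= \sum_b bin_weight e b.
  apply: le_trans (sum_bin_weight_ge e b).
  suff : expR (eta * n%:R / 8) - 1 <= excess (bin_count e b).
    by have := W1; lra.
  rewrite /excess le_max; apply/orP; left; rewrite lerD2r ler_expR -mulrA.
  by rewrite ler_wpM2l//; lra.
rewrite -mulr_suml ler_pdivrMr ?Z_gt0//.
apply: (@le_trans _ _ W).
  rewrite (eq_bigr (fun b => (b == ord0)%:R * W)); last first.
    by move=> b' hb'; rewrite /bin_weight small// add0r.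
  rewrite -mulr_suml ler_piMl ?(le_trans _ W1)//.
  rewrite (le_trans (@ler_sum_inj R _ _ id _ (fun b => (b == ord0)%:R) _ _))//.
  by rewrite (bigD1 ord0)//= big1 ?addr0// => i /negPf ->.
rewrite expRD expRN [_ / _ / delta]mulrAC -/W -[leRHS]mulrA ler_peMr//.
  by have := W1; lra.
by rewrite mulrC ler_pdivlMr ?expR_gt0// mul1r.
Qed.

End StableHistogram.

Local Open Scope classical_set_scope.
Local Open Scope ring_scope.

(** * Algorithms that factor through a finite encoding *)

Section AtomicLaw.
Context {R : realType}.
Variables (L : nat) (pt : nat -> R).
Implicit Types w v : 'I_L.+1 -> R.

Definition pmf w : Prop := (forall k, 0 <= w k) /\ \sum_k w k = 1.

(** [msum] runs over [nat] and [mscale] takes a nonnegative scalar, whence [inord] and the absolute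
    value; neither changes anything under [pmf]. *)
Definition atomic_measure w : {measure set R -> \bar R} :=
  msum (fun k => mscale `|w (inord k)|%:nng (\d_(pt k))) L.+1.

(* [mnormalize] is the identity on weights of total mass 1; it only serves to
   make every weight vector a probability. *)
Definition atomic_law w : probability R R :=
  mnormalize (atomic_measure w) (\d_(0 : R)).

Lemma atomic_measureE w A : pmf w ->
  atomic_measure w A = (\sum_k w k * \1_A (pt k))%:E.
Proof.
move=> [w0 w1]; rewrite /atomic_measure/= /msum -sumEFin; apply: eq_bigr => k _.
by rewrite /= /mscale /= diracE indicE EFinM inord_val ger0_norm.
Qed.

Lemma atomic_lawE w A : pmf w ->
  atomic_law w A = (\sum_k w k * \1_A (pt k))%:E.
Proof.
move=> pw; rewrite /atomic_law/= /mnormalize.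
have -> : atomic_measure w setT = 1%E.
  rewrite atomic_measureE//; congr EFin; case: pw => _ <-.
  by apply: eq_bigr => k _; rewrite indicT mulr1.
by rewrite onee_eq0/= invr1 mule1 atomic_measureE.
Qed.

Lemma integral_atomic_law w (f : R -> \bar R) : pmf w ->
  measurable_fun setT f -> (forall x, 0 <= f x)%E ->
  (\int[atomic_law w]_x f x = \sum_k (w k)%:E * f (pt k))%E.
Proof.
move=> pw mf f0.
rewrite (eq_measure_integral (atomic_measure w)); last first.
  by move=> A mA _; rewrite atomic_measureE//; exact: atomic_lawE.
rewrite ge0_integral_measure_sum//; apply: eq_bigr => k _.
rewrite ge0_integral_mscale//= integral_dirac//= diracT mul1e inord_val.
by rewrite ger0_norm//; case: pw.
Qed.

Hypothesis ptI : injective pt.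

Lemma atomic_law1 w (k : 'I_L.+1) : pmf w -> atomic_law w [set pt k] = (w k)%:E.
Proof.
move=> pw; rewrite atomic_lawE// (bigD1 k)//= big1 ?addr0.
  by rewrite indicE mem_set// mulr1.
move=> j jk; rewrite indicE memNset ?mulr0// => /ptI/val_inj jk'.
by rewrite jk' eqxx in jk.
Qed.

(** Positivity of [v] gives absolute continuity. The Radon-Nikodym derivative is known through its
    integrals only; integrating over the singleton of an atom yields its value [w k / v k] there. *)
Lemma renyi_atomic_law w v (a c : R) : pmf w -> pmf v ->
  (forall k, 0 < v k) -> 1 < a ->
  renyi_sum a w v <= expR (c * (a - 1)) ->
  (renyi_divergence a (atomic_law w) (atomic_law v) <= c%:E)%E.
Proof.
move=> pw pv v0 a1 wv.
have dom : atomic_law w `<< atomic_law v.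
  apply/null_content_dominatesP => A mA; rewrite atomic_lawE//.
  rewrite [X in X = _ -> _](atomic_lawE A pv) => -[] /eqP.
  rewrite psumr_eq0; last by move=> k _; apply: mulr_ge0; [exact: ltW|rewrite indicE].
  move=> /allP h; rewrite big1// => k _.
  have := h k; rewrite mem_index_enum => /(_ isT)/=.
  by rewrite mulf_eq0 gt_eqF//= => /eqP ->; rewrite mulr0.
rewrite /renyi_divergence asboolT//.
set f := Radon_Nikodym _ _.
have mf : measurable_fun setT f.
  by apply: (measurable_int (atomic_law v)); exact: Radon_Nikodym_integrable.
have fE (k : 'I_L.+1) : f (pt k) = (w k / v k)%:E.
  have : (charge_of_finite_measure (atomic_law w)) [set pt k] =
      (\int[atomic_law v]_(x in [set pt k]) f x)%E.
    exact: Radon_Nikodym_integral.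
  rewrite (eq_integral (cst (f (pt k)))); last by move=> x; rewrite inE => ->.
  rewrite integral_cst// => wE.
  have {}wE : ((w k)%:E = f (pt k) * (v k)%:E)%E.
    by rewrite -(atomic_law1 k pv) -(atomic_law1 k pw).
  have ffin : f (pt k) \is a fin_num by exact: Radon_Nikodym_fin_num.
  rewrite -(fineK ffin) in wE *.
  by move: wE => -[->]; rewrite mulfK// gt_eqF.
have -> : (\int[atomic_law v]_x f x `^ a = (renyi_sum a w v)%:E)%E.
  rewrite integral_atomic_law//.
  - by rewrite /renyi_sum -sumEFin; apply: eq_bigr => k _; rewrite fE poweR_EFin EFinM.
  - by apply: (measurableT_comp (measurable_poweR a)).
  - by move=> x; rewrite poweR_ge0.
have a10 : 0 < a - 1 by lra.
(* At nonpositive arguments [lne] is [-oo], and the bound is trivial. *)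
have [r0|r0] := lerP (renyi_sum a w v) 0.
  by rewrite le0_lneNy ?lee_fin// gt0_muleNy ?lte_fin ?invr_gt0// leNye.
rewrite lne_EFin// lee_fin ler_pdivrMl// mulrC.
by rewrite -ler_expR lnK// posrE.
Qed.

End AtomicLaw.

Section Encoding.
Context {R : realType}.
Variables (n : nat) (X : finType) (enc : R -> X).
Hypothesis menc : forall x, measurable (enc @^-1` [set x]).

Definition encode (xs : dataset R n) : {ffun 'I_n -> X} :=
  [ffun i => enc (tnth xs i)].

Lemma encode_neighbors (xs ys : dataset R n) :
  neighbors xs ys -> differ1 (encode xs) (encode ys).
Proof.
move=> /eqP/card1P[i hi]; exists i => j ji; rewrite !ffunE; congr enc.
by apply/eqP; have := hi j; rewrite !inE (negPf ji) => /negbFE.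
Qed.

Lemma measurable_encode e : measurable (encode @^-1` [set e]).
Proof.
have -> : encode @^-1` [set e] =
    \bigcap_(i in [set: 'I_n]) (fun xs : dataset R n => tnth xs i) @^-1`
      (enc @^-1` [set e i]).
  apply/seteqP; split => [xs /= <- i _ /=|xs h /=]; first by rewrite ffunE.
  by apply/ffunP => i; rewrite ffunE; exact: h.
apply: fin_bigcap_measurable; first exact: finite_finset.
by move=> i _; rewrite -[X in measurable X]setTI; exact: measurable_tnth.
Qed.

Section Algorithm.
Variable psi : {ffun 'I_n -> X} -> pprobability R R.

Definition encoded_fun (xs : dataset R n) : pprobability R R := psi (encode xs).

Lemma measurable_encoded_fun : measurable_fun setT encoded_fun.
Proof.
move=> _ Y mY; rewrite setTI.
have -> : encoded_fun @^-1` Y =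
    \bigcup_(e in [set e | Y (psi e)]) encode @^-1` [set e].
  apply/seteqP; split => [xs /= h|xs [e /= he xe]]; last by rewrite /= /encoded_fun xe.
  by exists (encode xs).
apply: fin_bigcup_measurable; first exact: finite_finset.
by move=> e _; exact: measurable_encode.
Qed.

HB.instance Definition _ :=
  isMeasurableFun.Build _ _ _ _ encoded_fun measurable_encoded_fun.

Definition encoded_algorithm : randomized_algorithm R n := encoded_fun.

Lemma output_lawE xs : output_law encoded_algorithm xs = psi (encode xs).
Proof. by []. Qed.

(** The events [ev e] partition the sample space according to the encoding, and independence gives
    their probabilities. *)
Lemma output_probE d (Omega : measurableType d) (P : probability Omega R)
    (D : probability R R) (xi : 'I_n -> {RV P >-> R}) (Y : set R) :
  iid_samples D xi ->
  (output_prob xi encoded_algorithm Y =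
   \sum_(e : {ffun 'I_n -> X}) (\prod_i D (enc @^-1` [set e i])) *
     (psi e : probability R R) Y)%E.
Proof.
move=> [ind id].
pose ev (e : {ffun 'I_n -> X}) : set Omega :=
  \bigcap_(i in [set` [set: 'I_n]%SET]) (xi i @^-1` (enc @^-1` [set e i])).
have mev e : measurable (ev e).
  apply: fin_bigcap_measurable => [|i _]; first exact: finite_finset.
  by rewrite -[X in measurable X]setTI; exact: measurable_funPT.
have evP e : P (ev e) = (\prod_i D (enc @^-1` [set e i]))%E.
  rewrite /ev ind//; rewrite (eq_bigl xpredT); last by move=> i; rewrite inE.
  by apply: eq_bigr => i _; rewrite -(id i).
rewrite /output_prob.
rewrite (eq_integral (fun w =>
    \sum_e (psi e : probability R R) Y * (\1_(ev e) w)%:E))%E; last first.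
  move=> w _; rewrite output_lawE.
  set e0 := encode _; rewrite (bigD1 e0)//= big1 ?adde0.
    rewrite indicE mem_set ?mule1// => i _ /=.
    by rewrite ffunE tnth_mktuple.
  move=> e ee0; rewrite indicE memNset ?mule0// => h.
  move/eqP : ee0; apply; apply/ffunP => i; rewrite ffunE tnth_mktuple.
  by apply/esym/h; rewrite /= inE.
rewrite ge0_integral_sum//.
- apply: eq_bigr => e _; rewrite ge0_integralZl//.
  + by rewrite integral_indic// setIT muleC; congr (_ * _)%E; exact: evP.
  + by apply/measurable_EFinP; exact: measurable_indic.
- by move=> e; apply: measurable_funeM; apply/measurable_EFinP; exact: measurable_indic.
- by move=> e w _; rewrite mule_ge0// lee_fin.
Qed.

End Algorithm.
End Encoding.

(** * Concentration of the clipped mean *)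

Section GridEncoding.
Context {R : realType}.
Variables (x0 s : R) (L : nat).
Hypothesis s0 : 0 < s.

(** Rounding down; [Num.truncn] sends negative numbers to 0 and [minn] caps at [L], so outliers are
    clamped to the end points. *)
Definition grid_enc (x : R) : 'I_L.+1 := inord (minn (Num.truncn ((x - x0) / s)) L).

Lemma grid_encE (x : R) : grid_enc x = minn (Num.truncn ((x - x0) / s)) L :> nat.
Proof. by rewrite inordK// ltnS geq_minr. Qed.

Lemma measurable_grid_enc l : measurable (grid_enc @^-1` [set l]).
Proof.
have mS j : measurable [set x | (j <= grid_enc x)%N].
  have [jL|Lj] := leqP j L; last first.
    rewrite (_ : [set x | _] = set0)//; apply/seteqP; split => // x /=.
    by apply/negP; rewrite -ltnNge (leq_trans _ Lj).
  case: j jL => [|j] jL.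
    by rewrite (_ : [set x | _] = setT)//; apply/seteqP; split.
  rewrite (_ : [set x | _] = [set` `[x0 + s * j.+1%:R, +oo[]).
    exact: measurable_itv.
  apply/seteqP; split => x /=; rewrite grid_encE leq_min jL andbT truncn_gt_nat;
    by rewrite in_itv/= andbT ler_pdivlMr// lerBrDl mulrC.
have -> : grid_enc @^-1` [set l] =
    [set x | (l <= grid_enc x)%N] `\` [set x | (l < grid_enc x)%N].
  apply/seteqP; split => [x /= <-|x /= [h1 /negP h2]].
    by split => //; rewrite ltnn.
  by apply/val_inj/eqP; rewrite eqn_leq h1 andbT leqNgt.
exact: measurableD.
Qed.

Lemma grid_enc_cases (x : R) :
  [\/ x < x0 /\ grid_enc x = 0%N :> nat,
      x0 + s * L%:R <= x /\ grid_enc x = L :> nat |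
      `|grid_pt x0 s (grid_enc x) - x| <= s].
Proof.
have s_gt0 := s0.
have [xx0|x0x] := ltrP x x0.
  constructor 1; split => //; rewrite grid_encE (_ : Num.truncn _ = 0%N) ?min0n//.
  have h : x - x0 < s by lra.
  by apply/truncn0Pn; rewrite -ltNge ltr_pdivrMr// mul1r.
have y0 : 0 <= (x - x0) / s by rewrite divr_ge0 ?subr_ge0// ltW.
have [xL|Lx] := lerP (x0 + s * L%:R) x.
  constructor 2; split => //; rewrite grid_encE; apply/minn_idPr.
  by rewrite truncn_ge_nat// ler_pdivlMr// lerBrDl mulrC.
constructor 3.
have e : grid_enc x = Num.truncn ((x - x0) / s) :> nat.
  rewrite grid_encE; apply/minn_idPl/ltnW.
  by rewrite truncn_lt_nat// ltr_pdivrMr// ltrBlDl mulrC.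
have := truncn_itv y0; rewrite -e ler_pdivlMr// ltr_pdivrMr// => /andP[h1 h2].
rewrite /grid_pt ler_norml; move: h2; rewrite -natr1; nra.
Qed.

Variables (mu T : R).
Hypotheses (T0 : 0 < T) (sT : s <= T / 4).
Hypotheses (mulo : x0 + T <= mu) (muhi : mu + T <= x0 + s * L%:R).

(** Both ends of the grid are at least [T] away from [mu], so a sample encoded near [mu] was not
    clamped. *)
Lemma grid_enc_near (x : R) : `|grid_pt x0 s (grid_enc x) - mu| <= T / 2 ->
  `|grid_pt x0 s (grid_enc x) - x| <= s.
Proof.
have [T_gt0 lo hi] := And3 T0 mulo muhi.
case: (grid_enc_cases x) => // -[h e]; rewrite /grid_pt e ler_norml.
  by rewrite mulr0; lra.
by lra.
Qed.

Lemma grid_enc_far (x : R) : T / 2 < `|grid_pt x0 s (grid_enc x) - mu| ->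
  T / 4 <= `|x - mu|.
Proof.
have [T_gt0 lo hi sT4] := And4 T0 mulo muhi sT.
case: (grid_enc_cases x) => [[h e] _|[h e] _|h far].
- by rewrite ler_normr; apply/orP; right; lra.
- by rewrite ler_normr; apply/orP; left; lra.
- have := ler_distD x (grid_pt x0 s (grid_enc x)) mu; lra.
Qed.

End GridEncoding.

(** * Moment bounds and their transfer to encoded samples *)

Section Moments.
Context {R : realType}.

(** The [(k - 1)]-th power of the threshold is that of [C] divided by [alpha], hence at least
    [C / alpha] as [k - 1 >= 1]. *)
Lemma le_powR_tail (k alpha C z : R) : 2 <= k -> 0 < alpha -> 1 <= C ->
  C * alpha `^ (- (k - 1)^-1) <= z -> z <= alpha / C * z `^ k.
Proof.
move=> k2 a0 C1 hz.
have k1 : 0 < k - 1 by lra.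
have A0 : 0 < alpha `^ (- (k - 1)^-1) by rewrite powR_gt0.
have z0 : 0 < z by apply: lt_le_trans hz; rewrite mulr_gt0//; lra.
have zk : z `^ k = z * z `^ (k - 1).
  by rewrite mulr_powRB1 ?ltW//; lra.
have h : C / alpha <= z `^ (k - 1).
  apply: (@le_trans _ _ ((C * alpha `^ (- (k - 1)^-1)) `^ (k - 1))).
    rewrite powRM ?(ltW A0)//; last lra.
    rewrite -powRrM mulNr mulVf ?gt_eqF// powR_inv1 ?(ltW a0)//.
    rewrite ler_pM2r ?invr_gt0// -{1}(powRr1 (_ : 0 <= C)); last lra.
    by rewrite ler_powR//; lra.
  by rewrite ge0_ler_powR ?nnegrE ?(ltW z0) ?(ltW k1)// mulr_ge0 ?ltW//; lra.
have C0 : 0 < C by lra.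
rewrite zk mulrCA -[leLHS]mulr1 ler_pM2l//.
have := ler_wpM2l (_ : 0 <= alpha / C) h => /(_ _)/wrap[]; first by rewrite divr_ge0 ?ltW.
have -> : alpha / C * (C / alpha) = 1 by field; rewrite !gt_eqF.
by [].

Qed.

Lemma sqr_le1Dpow (k z : R) : 2 <= k -> 0 <= z -> z ^+ 2 <= 1 + z `^ k.
Proof.
move=> k2 z0; have [z1|z1] := lerP z 1.
  apply: (@le_trans _ _ 1); last by rewrite lerDl powR_ge0.
  exact: exprn_ile1.
by rewrite -powR_mulrn// ler_wpDl// ler_powR// ltW.
Qed.

Lemma integral_encoded (X : finType) (enc : R -> X) (D : probability R R)
    (G : X -> R) :
  (forall x, measurable (enc @^-1` [set x])) -> (forall l, 0 <= G l) ->
  (\int[D]_x (G (enc x))%:E =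
    (\sum_l fine (D (enc @^-1` [set l])) * G l)%:E)%E.
Proof.
move=> menc G0.
rewrite (eq_integral (fun x =>
    \sum_l (G l)%:E * (\1_(enc @^-1` [set l]) x)%:E))%E; last first.
  move=> x _; rewrite (bigD1 (enc x))//= big1 ?adde0.
    by rewrite indicE mem_set// mule1.
  move=> l lx; rewrite indicE memNset ?mule0//= => xl.
  by rewrite xl eqxx in lx.
have mi l : measurable_fun setT (fun x : R => (\1_(enc @^-1` [set l]) x)%:E : \bar R).
  by apply/measurable_EFinP; exact: measurable_indic.
rewrite ge0_integral_sum//.
- rewrite -sumEFin; apply: eq_bigr => l _; rewrite ge0_integralZl//.
    rewrite integral_indic// setIT muleC EFinM fineK//.
    by apply: fin_num_measure.
  by rewrite lee_fin.
- by move=> l; apply: measurable_funeM.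
- by move=> l x _; rewrite mule_ge0// lee_fin// indicE.
Qed.

(** The linear term has mean zero and the power term mean at most 1. *)
Lemma encoded_moment (X : finType) (enc : R -> X) (D : probability R R)
    (mu k a0 a1 a2 : R) (G : X -> R) :
  (forall x, measurable (enc @^-1` [set x])) ->
  has_mean D mu -> (abs_central_moment D mu k <= 1)%E ->
  0 <= a2 -> (forall l, 0 <= G l) ->
  (forall x, G (enc x) <= a0 + a1 * (x - mu) + a2 * `|x - mu| `^ k) ->
  \sum_l fine (D (enc @^-1` [set l])) * G l <= a0 + a2.
Proof.
move=> menc [iD mD] mom a20 G0 hG.
have mpow : measurable_fun setT (fun x : R => (`|x - mu| `^ k)%:E : \bar R).
  apply/measurable_EFinP; apply: (measurableT_comp (measurable_powR k)).
  apply: measurableT_comp => //; exact: measurable_funB.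
have ipow : D.-integrable setT (fun x : R => (`|x - mu| `^ k)%:E).
  apply/integrableP; split => //.
  rewrite (eq_integral (fun x : R => (`|x - mu| `^ k)%:E)).
    by rewrite (le_lt_trans mom)// ltry.
  by move=> x _; rewrite gee0_abs// lee_fin powR_ge0.
have icst (c : R) : D.-integrable setT (fun _ : R => c%:E).
  exact: finite_measure_integrable_cst.
have ix : D.-integrable setT (fun x : R => (a1%:E * x%:E)%E).
  exact: integrableZl.
have ip2 : D.-integrable setT (fun x : R => (a2%:E * (`|x - mu| `^ k)%:E)%E).
  exact: integrableZl.
have ic1 : D.-integrable setT (fun x : R => ((a0 - a1 * mu)%:E + a1%:E * x%:E)%E).
  exact: integrableD.
rewrite -lee_fin -integral_encoded//.
apply: (@le_trans _ _ (\int[D]_x ((a0 - a1 * mu)%:E + a1%:E * x%:E +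
    a2%:E * (`|x - mu| `^ k)%:E))%E).
  apply: ge0_le_integral => //.
  - by move=> x _; rewrite lee_fin.
  - apply/measurable_EFinP.
    move=> _ Y mY; rewrite setTI.
    have -> : (fun x => G (enc x)) @^-1` Y =
        \bigcup_(l in [set l | Y (G l)]) enc @^-1` [set l].
      apply/seteqP; split => [x /= h|x [l /= hl xl]]; last by rewrite /= xl.
      by exists (enc x).
    by apply: fin_bigcup_measurable => //; exact: finite_finset.
  - by apply: measurable_int; exact: integrableD ic1 ip2.
  - move=> x _; rewrite -!EFinM -!EFinD lee_fin; apply: (le_trans (hG x)).
    by rewrite lerD2r le_eqVlt; apply/orP; left; apply/eqP; ring.
rewrite integralD//= integralD//= integralZl//= integralZl//= mD.
rewrite integral_cst//= probability_setT mule1.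
apply: (@le_trans _ _ ((a0 - a1 * mu)%:E + a1%:E * mu%:E + a2%:E * 1)%E).
  by rewrite leeD2l// lee_wpmul2l// lee_fin.
by rewrite mule1 -EFinM -!EFinD lee_fin; lra.
Qed.

End Moments.

Section Concentration.
Context {R : realType}.
Variables (x0 s : R) (L n : nat) (mu T k alpha sg : R).
Hypotheses (s0 : 0 < s) (alpha0 : 0 < alpha) (alpha1 : alpha <= 1).
Hypotheses (k2 : 2 <= k) (sE : s = alpha / 16).
Hypothesis TE : T = 4 * (272 * alpha `^ (- (k - 1)^-1)).
Hypotheses (mulo : x0 + T <= mu) (muhi : mu + T <= x0 + s * L%:R).
Hypothesis sg1 : `|sg| = 1.

(* Bounds the [sg]-signed deviation from [mu] of a sample clipped to any window
   of radius [2 * T] whose center is close to [mu]; summing both signs also counts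
   the samples at distance more than [T / 2] from [mu]. *)
Definition signed_dev (l : nat) : R :=
  if `|grid_pt x0 s l - mu| <= T / 2 then sg * (grid_pt x0 s l - mu) else 4 * T.

(** As [alpha * T <= 1088], this keeps [theta * (4 * T)] below [1 / 2], where the quadratic bound on
    [expR] applies. *)
Let theta : R := alpha / (100 * 100).

Lemma T_ge : 1088 <= T.
Proof.
have kge := k2.
rewrite TE; suff : 1 <= alpha `^ (- (k - 1)^-1) by lra.
rewrite -[leLHS](powRr0 alpha) ger_powR ?alpha0//.
by rewrite oppr_le0 invr_ge0; lra.
Qed.

Lemma alphaT_le : alpha * T <= 1088.
Proof.
have kge := k2.
rewrite TE; suff : alpha * alpha `^ (- (k - 1)^-1) <= 1 by nra.
rewrite -{1}(powRr1 (ltW alpha0)) -powRD; last by rewrite (gt_eqF alpha0) implybT.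
rewrite -[leRHS](powRr0 alpha) ger_powR ?alpha0// subr_ge0.
by rewrite invf_le1; lra.
Qed.

Lemma signed_dev_moment (D : probability R R) :
  has_mean D mu -> (abs_central_moment D mu k <= 1)%E ->
  \sum_l fine (D (@grid_enc _ x0 s L @^-1` [set l])) *
    expR (theta * signed_dev l) <= expR (theta * alpha / 8 + 1028 * theta ^+ 2).
Proof.
move=> mD mom.
have T1 := T_ge; have aT := alphaT_le.
have [s_gt0 a_gt0 a_le1 kge] := And4 s0 alpha0 alpha1 k2.
have s16 := sE.
have th0 : 0 < theta by rewrite divr_gt0.
have sT : s <= T / 4 by lra.
have T0 : 0 < T by lra.
apply: le_trans (expR_ge1Dx _).
apply: (@le_trans _ _ ((1 + theta * s + 516 * theta ^+ 2) +
    (theta * (alpha / 16) + 512 * theta ^+ 2))); last by rewrite sE; nra.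
have a2_ge0 : 0 <= theta * (alpha / 16) + 512 * theta ^+ 2.
  apply: addr_ge0; last by apply: mulr_ge0; [exact: ler0n|exact: sqr_ge0].
  by apply: mulr_ge0; lra.
apply: (@encoded_moment _ _ _ _ mu k _ (theta * sg) _
  (fun l : 'I_L.+1 => expR (theta * signed_dev l))
  (measurable_grid_enc x0 s0) mD mom a2_ge0 (fun=> expR_ge0 _)).
move=> x; set y := grid_pt x0 s (grid_enc x0 s L x).
pose z : R := `|x - mu|; rewrite -/z; have z0 : 0 <= z by exact: normr_ge0.
have zk0 : 0 <= z `^ k by exact: powR_ge0.
set U := signed_dev _.
have zsg : `|sg * (x - mu)| = z by rewrite normrM sg1 mul1r.
have U4 : U <= 4 * T.
  rewrite /U /signed_dev -/y; case: ifP => // hy.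
  have : `|sg * (y - mu)| <= T / 2 by rewrite normrM sg1 mul1r.
  by rewrite ler_norml; lra.
(* [U1] and [U2] control the linear and quadratic terms of the exponential; doubled, 258 and 256
   become the 516 and 512 above. *)
have [U1 U2] : U <= sg * (x - mu) + s + alpha / 16 * z `^ k /\
    U ^+ 2 <= 258 + 256 * z `^ k.
  have zz := sqr_le1Dpow k2 z0.
  rewrite /U /signed_dev -/y; have [hy|hy] := lerP `|y - mu| (T / 2).
    have yx := grid_enc_near s0 T0 mulo muhi hy.
    have yx' : `|sg * (y - mu) - sg * (x - mu)| <= s.
      by rewrite -mulrBr normrM sg1 mul1r opprB addrA subrK.
    split.
      have : 0 <= alpha / 16 * z `^ k by rewrite mulr_ge0// divr_ge0// ltW.
      by move: yx'; rewrite ler_norml; lra.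
    have s2 : s <= 1 by lra.
    have h : `|sg * (y - mu)| <= z + 1.
      have := ler_distD (sg * (x - mu)) (sg * (y - mu)) 0.
      by rewrite !subr0 zsg; lra.
    have : (sg * (y - mu)) ^+ 2 <= (z + 1) ^+ 2.
      by rewrite -real_normK ?num_real// lerXn2r ?nnegrE//; lra.
    by nra.
  (* Here [4 * T <= 16 * z], and one more [z] pays for the sign of [sg * (x - mu)]: hence 272, which
     is [16 * 17]. *)
  have zT := grid_enc_far s0 T0 sT mulo muhi hy; rewrite -/z in zT.
  have tail : z <= alpha / 272 * z `^ k.
    by apply: le_powR_tail => //; rewrite TE in zT; lra.
  split; last by nra.
  have : - z <= sg * (x - mu) by have := lexx z; rewrite -{1}zsg ler_norml => /andP[].
  by lra.
have thU : theta * U <= 1 / 2.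
  have : theta * U <= theta * (4 * T) by rewrite ler_pM2l.
  by rewrite /theta; lra.
apply: (le_trans (expR_le1DxD2sqr thU)).
have h1 : theta * U <= theta * (sg * (x - mu) + s + alpha / 16 * z `^ k).
  by rewrite ler_pM2l.
have h2 : theta ^+ 2 * U ^+ 2 <= theta ^+ 2 * (258 + 256 * z `^ k).
  by rewrite ler_pM2l// exprn_gt0.
by rewrite exprMn; lra.
Qed.

Lemma signed_dev_tail (D : probability R R) :
  has_mean D mu -> (abs_central_moment D mu k <= 1)%E ->
  \sum_(e : {ffun 'I_n -> 'I_L.+1} | n%:R * (alpha / 2) <= \sum_i signed_dev (e i))
    \prod_i fine (D (@grid_enc _ x0 s L @^-1` [set e i])) <=
  expR (- (n%:R * alpha ^+ 2 / (200 * 200))).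
Proof.
move=> mD mom.
have th0 : 0 <= theta by rewrite divr_ge0// ltW.
have D0 l : 0 <= fine (D (@grid_enc _ x0 s L @^-1` [set l])) by exact: fine_ge0.
have := @chernoff_iid _ n _ _ (fun l : 'I_L.+1 => signed_dev l) theta
  (alpha / 2) _ th0 D0 (signed_dev_moment mD mom).
move=> /le_trans; apply; rewrite ler_expR -[X in _ <= - X]mulrA -[leRHS]mulrN.
apply: ler_wpM2l; first exact: ler0n.
(* Numerically, [1028 / 10 ^ 8 - 3 / (8 * 10 ^ 4) <= - 1 / (200 * 200)]. *)
rewrite /theta; have := sqr_ge0 alpha; nra.
Qed.

End Concentration.

(** * The estimator *)

Section Clip.
Context {R : realType}.
Implicit Types c rad x y : R.

Definition clip c rad x : R := Num.max (c - rad) (Num.min (c + rad) x).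

Lemma clip_itv c rad x : 0 <= rad -> c - rad <= clip c rad x <= c + rad.
Proof.
move=> r0; rewrite /clip le_max lexx/= ge_max ge_min lexx/= andbT.
by lra.
Qed.

Lemma clip_id c rad x : `|x - c| <= rad -> clip c rad x = x.
Proof.
rewrite ler_norml => /andP[h1 h2]; rewrite /clip min_r ?max_r//; lra.
Qed.

Lemma clip_dist c rad x y : 0 <= rad ->
  `|clip c rad x - clip c rad y| <= 2 * rad.
Proof.
by move=> r0; have := clip_itv c x r0; have := clip_itv c y r0; rewrite ler_norml; lra.
Qed.

End Clip.

Section Estimator.
Context {R : realType}.
Variables (n L : nat) (x0 s T lam : R).
Hypotheses (s0 : 0 < s) (T0 : 0 < T) (sT : s <= T).
Implicit Types e : {ffun 'I_n -> 'I_L.+1}.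

Local Notation pt := (grid_pt x0 s).

(** Bins of width [T] share the index type of the grid cells: as [s <= T], there are no more of
    them. *)
Definition bin_of (l : 'I_L.+1) : 'I_L.+1 := inord (Num.truncn (s * l%:R / T)).

Definition clipped_mean e (b : nat) : R :=
  n%:R^-1 * \sum_i clip (grid_pt x0 T b) (2 * T) (pt (e i)).

Definition fine_law e (b : nat) : 'I_L.+1 -> R :=
  softmax (fun g : 'I_L.+1 => - (lam * `|clipped_mean e b - pt g|)).

Lemma fine_law_gt0 e b g : 0 < fine_law e b g.
Proof. exact: softmax_gt0. Qed.

Lemma sum_fine_law e b : \sum_g fine_law e b g = 1.
Proof. exact: (sum_softmax _ ord0). Qed.

Lemma clipped_mean_differ1 e e' b : differ1 e e' ->
  `|clipped_mean e b - clipped_mean e' b| <= 4 * T / n%:R.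
Proof.
move=> ee'; rewrite -mulrBr normrM ger0_norm ?invr_ge0// [leRHS]mulrC.
apply: ler_wpM2l; first by rewrite invr_ge0.
apply: (@ler_dist_sum1 _ _ _ (fun l : 'I_L.+1 => clip _ _ (pt l)) _ _ _ ee').
move=> x y; have -> : 4 * T = 2 * (2 * T) by ring.
by apply: clip_dist; rewrite mulr_ge0// ltW.
Qed.

(** The clipped mean has sensitivity [4 * T / n], and [lam] is calibrated so that [eps] is twice
    [lam] times this. *)
Lemma fine_law_pure e e' b eps : 0 <= lam -> lam * (8 * T) = eps * n%:R ->
  (0 < n)%N -> differ1 e e' ->
  forall g, fine_law e b g <= expR eps * fine_law e' b g.
Proof.
move=> lam0 lamE n0 ee' g.
have nR : 0 < n%:R :> R by rewrite ltr0n.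
have -> : eps = 2 * (lam * (4 * T / n%:R)).
  apply: (@mulIf _ n%:R); first by rewrite gt_eqF.
  by rewrite -lamE; field; rewrite gt_eqF.
apply: softmax_pure => g' /=.
rewrite opprK addrC -mulrBr normrM ger0_norm// distrC.
apply: ler_wpM2l => //.
apply: le_trans (clipped_mean_differ1 b ee').
apply: le_trans (ler_dist_dist _ _) _.
by rewrite opprB addrA subrK.
Qed.

Lemma fine_law_tail e b (mu alpha : R) : 0 <= lam -> 2 * s <= alpha ->
  x0 + alpha <= mu -> mu + alpha <= x0 + s * L%:R ->
  `|clipped_mean e b - mu| <= alpha / 2 ->
  \sum_(g < L.+1 | alpha < `|mu - pt g|) fine_law e b g <=
  2 * expR (- (lam * s)).
Proof.
move=> lam0 s2 lo hi; have s_gt0 := s0; move=> hmu.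
have itv : x0 <= clipped_mean e b <= x0 + s * L%:R.
  by move: hmu; rewrite ler_norml; lra.
apply: le_trans (softmax_grid_tail s0 lam0 itv).
rewrite big_mkcond [leRHS]big_mkcond ler_sum// => g _.
case: ifPn => far; last by case: ifP => // _; rewrite ltW// softmax_gt0.
suff -> : s <= `|clipped_mean e b - pt g| by [].
have := ler_distD (clipped_mean e b) mu (pt g).
by rewrite [`|mu - clipped_mean e b|]distrC; lra.
Qed.

Section TrueMean.
Variables (mu alpha : R).
Hypotheses (mulo : x0 + T <= mu) (muhi : mu + T <= x0 + s * L%:R).
Hypotheses (alpha0 : 0 < alpha) (alpha1 : alpha <= 1) (T1 : 1 <= T) (n0 : (0 < n)%N).

(** An interval of length [T] meets at most two consecutive bins of width [T]. *)
Lemma near_bins : exists b1 b2 : 'I_L.+1,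
  (forall l : 'I_L.+1, `|pt l - mu| <= T / 2 -> bin_of l \in [:: b1; b2]) /\
  (forall b : 'I_L.+1, b \in [:: b1; b2] -> `|grid_pt x0 T b - mu| <= 3 / 2 * T).
Proof.
have [lo hi T_gt0 sleT] := And4 mulo muhi T0 sT; have s_gt0 := s0.
pose t := (mu - T / 2 - x0) / T.
have t0 : 0 <= t by rewrite divr_ge0; lra.
pose b := Num.truncn t.
have /andP[b_le b_gt] := truncn_itv t0; rewrite -/b in b_le b_gt.
have bT1 : b%:R * T <= mu - T / 2 - x0 by rewrite -ler_pdivlMr.
have bT2 : mu - T / 2 - x0 < (b%:R + 1) * T.
  by rewrite natr1 -ltr_pdivrMr.
have bL : (b.+1 < L.+1)%N.
  rewrite ltnS -(ler_nat R) -(ler_pM2r T0) -natr1.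
  have : s * L%:R <= L%:R * T by rewrite mulrC ler_wpM2l.
  by nra.
have b1E : nat_of_ord (inord b : 'I_L.+1) = b by rewrite inordK// ltnW.
have b2E : nat_of_ord (inord b.+1 : 'I_L.+1) = b.+1 by rewrite inordK.
exists (inord b), (inord b.+1); split.
  move=> l; rewrite ler_norml /grid_pt => /andP[l1 l2].
  have sl0 : 0 <= s * l%:R / T by rewrite divr_ge0 ?mulr_ge0// ltW.
  have lT1 : b%:R <= s * l%:R / T by rewrite ler_pdivlMr//; lra.
  have lT2 : s * l%:R / T < b.+2%:R.
    by rewrite ltr_pdivrMr// -natr1 -natr1; nra.
  have : (b <= Num.truncn (s * l%:R / T) < b.+2)%N.
    by rewrite truncn_ge_nat// lT1 truncn_lt_nat.
  rewrite /bin_of !inE; move: (Num.truncn _) => j /andP[].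
  rewrite leq_eqVlt => /predU1P[<- _|bj]; first by rewrite eqxx.
  rewrite ltnS => jb; have -> : j = b.+1 by apply/eqP; rewrite eqn_leq jb.
  by rewrite eqxx orbT.
move=> c; rewrite !inE => /orP[] /eqP ->;
  rewrite /grid_pt ?b1E ?b2E ler_norml ?[b.+1%:R]mulrS; nra.
Qed.

Local Notation dev sg := (signed_dev x0 s mu T sg).

Definition typical e : bool :=
  (\sum_i dev 1 (e i) < n%:R * (alpha / 2)) &&
  (\sum_i dev (- 1) (e i) < n%:R * (alpha / 2)).

(** Adding both signs, near samples cancel and each far one counts [8 * T], so at most
    [n * alpha / (8 * T)] samples are far. *)
Lemma typical_few e (b1 b2 : 'I_L.+1) : typical e ->
  (forall l : 'I_L.+1, `|pt l - mu| <= T / 2 -> bin_of l \in [:: b1; b2]) ->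
  4 * \sum_i (bin_of (e i) \notin [:: b1; b2])%:R <= n%:R :> R.
Proof.
move=> /andP[h1 h2] near; have [T_ge1 a_gt0 a_le1] := And3 T1 alpha0 alpha1.
set F := \sum_i _.
have F0 : 0 <= F by rewrite sumr_ge0.
have : 8 * T * F <= \sum_i dev 1 (e i) + \sum_i dev (- 1) (e i).
  rewrite -big_split/= mulr_sumr ler_sum// => i _.
  rewrite /signed_dev; have [h|h] := lerP `|pt (e i) - mu| (T / 2).
    by rewrite near// mulr0 mul1r mulN1r subrr.
  have : (bin_of (e i) \notin [:: b1; b2])%:R <= 1 :> R by case: (_ \notin _).
  by move=> b1'; nra.
have : 0 <= n%:R :> R by [].
by nra.
Qed.

(** Clipping fixes near samples, as [T / 2 + 3 / 2 * T = 2 * T]; a far one deviates after clipping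
    by at most [7 / 2 * T], below the [4 * T] charged by [signed_dev]. *)
Lemma typical_mean e (b : 'I_L.+1) : typical e ->
  `|grid_pt x0 T b - mu| <= 3 / 2 * T -> `|clipped_mean e b - mu| <= alpha / 2.
Proof.
move=> /andP[h1 h2]; have T_gt0 := T0; rewrite ler_norml => /andP[c1 c2].
have nR : 0 < n%:R :> R by rewrite ltr0n.
have TT : 0 <= 2 * T by lra.
have up i : clip (grid_pt x0 T b) (2 * T) (pt (e i)) - mu <= dev 1 (e i).
  rewrite /signed_dev; have [h|h] := lerP `|pt (e i) - mu| (T / 2).
    by rewrite clip_id ?mul1r//; move: h; rewrite !ler_norml; lra.
  by have := clip_itv (grid_pt x0 T b) (pt (e i)) TT; lra.
have dn i : - (clip (grid_pt x0 T b) (2 * T) (pt (e i)) - mu) <= dev (- 1) (e i).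
  rewrite /signed_dev; have [h|h] := lerP `|pt (e i) - mu| (T / 2).
    by rewrite clip_id ?mulN1r//; move: h; rewrite !ler_norml; lra.
  by have := clip_itv (grid_pt x0 T b) (pt (e i)) TT; lra.
have mE : clipped_mean e b - mu =
    n%:R^-1 * \sum_i (clip (grid_pt x0 T b) (2 * T) (pt (e i)) - mu).
  rewrite sumrB sumr_const card_ord -[mu *+ n]mulr_natl mulrBr mulKf//.
  by rewrite gt_eqF.
rewrite mE ler_norml; apply/andP; split.
  rewrite lerNl -mulrN -sumrN ler_pdivrMl//.
  by apply: le_trans (ltW h2); rewrite ler_sum.
rewrite ler_pdivrMl//.
by apply: le_trans (ltW h1); rewrite ler_sum.
Qed.

End TrueMean.

Section Mechanism.
Variables (W : finType) (coarse : {ffun 'I_n -> 'I_L.+1} -> W -> R).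
Variable dec : W -> 'I_L.+1.
Hypothesis coarse0 : forall e w, 0 <= coarse e w.
Hypothesis coarse1 : forall e, \sum_w coarse e w = 1.

Definition mech e (g : 'I_L.+1) : R :=
  \sum_w coarse e w * fine_law e (dec w) g.

Lemma pmf_mech e : pmf (mech e).
Proof.
split.
  by move=> g; rewrite sumr_ge0// => w _; rewrite mulr_ge0// ltW// fine_law_gt0.
rewrite exchange_big/= -(coarse1 e); apply: eq_bigr => w _.
by rewrite -mulr_sumr sum_fine_law mulr1.
Qed.

Lemma mech_far e (mu alpha bc bf : R) (b1 b2 : 'I_L.+1) :
  \sum_(w | dec w \notin [:: b1; b2]) coarse e w <= bc ->
  0 <= bf ->
  (forall b, b \in [:: b1; b2] ->
    \sum_(g < L.+1 | alpha < `|mu - pt g|) fine_law e b g <= bf) ->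
  \sum_(g < L.+1 | alpha < `|mu - pt g|) mech e g <= bc + bf.
Proof.
move=> hc bf0 hf; rewrite exchange_big/=.
rewrite (bigID (fun w => dec w \notin [:: b1; b2]))/=; apply: lerD.
  apply: le_trans hc; apply: ler_sum => w _.
  rewrite -mulr_sumr ler_piMr// -(sum_fine_law e (dec w)).
  rewrite [leRHS](bigID (fun g : 'I_L.+1 => alpha < `|mu - pt g|))/= lerDl.
  by rewrite sumr_ge0// => g _; rewrite ltW// fine_law_gt0.
apply: (@le_trans _ _ (\sum_w coarse e w * bf)).
  rewrite big_mkcond ler_sum// => w _; case: ifPn => hw.
    by rewrite -mulr_sumr ler_wpM2l// hf// -[_ \in _]negbK.
  by rewrite mulr_ge0.
by rewrite -mulr_suml coarse1 mul1r.
Qed.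

Definition estimator : randomized_algorithm R n :=
  encoded_algorithm (measurable_grid_enc x0 (L := L) s0)
    (fun e => atomic_law pt (mech e)).

(** Union bound with [beta / 3] each for an atypical sample, a wrong bin and a bad grid point. *)
Lemma estimator_estimates (k r alpha beta : R) :
  2 <= k -> 0 < alpha -> alpha <= 1 -> 0 <= beta -> (0 < n)%N -> 0 <= lam ->
  s = alpha / 16 -> T = 4 * (272 * alpha `^ (- (k - 1)^-1)) ->
  x0 = - (r + T) -> 2 * (r + T) <= s * L%:R ->
  2 * expR (- (n%:R * alpha ^+ 2 / (200 * 200))) <= beta / 3 ->
  2 * expR (- (lam * s)) <= beta / 3 ->
  (forall e b1 b2, 4 * \sum_i (bin_of (e i) \notin [:: b1; b2])%:R <= n%:R :> R ->
     \sum_(w | dec w \notin [:: b1; b2]) coarse e w <= beta / 3) ->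
  estimates_mean k r alpha beta estimator.
Proof.
move=> k2 a0 a1 beta0 n0 lam0 sE TE x0E rT hconc hfine hcoarse.
move=> D mu mD /andP[mulo' muhi'] mom d Omega P xi iid.
have T_ge1 : 1088 <= T := T_ge a0 a1 k2 TE.
have T1 : 1 <= T by lra.
have mulo : x0 + T <= mu by lra.
have muhi : mu + T <= x0 + s * L%:R by lra.
have [b1 [b2 [near cen]]] := near_bins mulo muhi.
rewrite (output_probE _ _ _ iid).
pose p (l : 'I_L.+1) := fine (D (grid_enc x0 s L @^-1` [set l])).
have pE l : D (grid_enc x0 s L @^-1` [set l]) = (p l)%:E.
  by rewrite fineK// fin_num_measure//; exact: measurable_grid_enc.
have p0 l : 0 <= p l by exact: fine_ge0.
have p1 : \sum_l p l = 1.
  have := @integral_encoded _ _ (grid_enc x0 s L) D (fun=> 1)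
    (measurable_grid_enc x0 s0) (fun=> ler01).
  rewrite integral_cst// mul1e [X in X = _ -> _](probability_setT D) => -[->].
  by apply: eq_bigr => l _; rewrite mulr1.
pose Pr e := \prod_i p (e i).
have Pr0 e : 0 <= Pr e by rewrite prodr_ge0.
have Pr1 : \sum_e Pr e = 1.
  rewrite -(bigA_distr_bigA (fun (i : 'I_n) l => p l))/=.
  by apply: big1 => i _.
pose typ := typical mu alpha.
pose far e := \sum_(g < L.+1 | alpha < `|mu - pt g|) mech e g.
have typ_far e : typ e -> far e <= beta / 3 + beta / 3.
  move=> te; apply: (mech_far (b1 := b1) (b2 := b2)).
  - by apply: hcoarse; exact: (typical_few a0 a1 T1 te near).
  - by rewrite divr_ge0.
  - move=> b /cen cb; apply: le_trans hfine; apply: fine_law_tail => //; try lra.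
    exact: (typical_mean n0 te cb).
have atyp : \sum_(e | ~~ typ e) Pr e <= beta / 3.
  apply: le_trans hconc.
  have tail sg : `|sg| = 1 -> \sum_(e : {ffun 'I_n -> 'I_L.+1} |
      n%:R * (alpha / 2) <= \sum_i signed_dev x0 s mu T sg (e i)) Pr e <=
      expR (- (n%:R * alpha ^+ 2 / (200 * 200))).
    by move=> sg1; apply: signed_dev_tail mD mom.
  have -> : forall z : R, 2 * z = z + z by move=> z; ring.
  apply: le_trans (lerD (tail 1 (normr1 _)) (tail (- 1) (normrN1 _))).
  rewrite big_mkcond [X in _ <= X + _]big_mkcond [X in _ <= _ + X]big_mkcond.
  rewrite -big_split/= ler_sum// => e _; have := Pr0 e => P0.
  rewrite /typ /typical negb_and -!leNgt.
  case: ifP => /= [/orP[]->|_]; last by rewrite addr_ge0//; case: ifP.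
    by rewrite lerDl; case: ifP.
  by rewrite lerDr; case: ifP.
pose hit e := \sum_g mech e g * \1_[set m | `|mu - m| <= alpha] (pt g).
have hitE e : hit e = 1 - far e.
  have [_ <-] := pmf_mech e.
  rewrite (bigID (fun g : 'I_L.+1 => alpha < `|mu - pt g|))/= addrC addrK.
  rewrite [RHS]big_mkcond; apply: eq_bigr => g _.
  rewrite indicE; case: ltrP => h; last by rewrite mem_set ?mulr1.
  by rewrite memNset ?mulr0//= => h'; move: (lt_le_trans h h'); rewrite ltxx.
have hit0 e : 0 <= hit e.
  have [m0 _] := pmf_mech e; rewrite sumr_ge0// => g _.
  by rewrite mulr_ge0// indicE.
rewrite (eq_bigr (fun e => (Pr e * hit e)%:E)); last first.
  move=> e _; rewrite EFinM; congr (_ * _)%E; last first.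
    by apply: (atomic_lawE _ _ (pmf_mech e)).
  by rewrite -prodEFin; apply: eq_bigr => i _; exact: pE.
rewrite sumEFin lee_fin.
apply: (@le_trans _ _ (\sum_e (Pr e * (1 - (beta / 3 + beta / 3)) -
    (if ~~ typ e then Pr e else 0)))).
  rewrite sumrB -mulr_suml Pr1 mul1r -big_mkcond/=.
  by lra.
rewrite ler_sum// => e _; have := Pr0 e; have := hit0 e; have := typ_far e.
rewrite hitE; case: (typ e) => /=; last by nra.
by move=> /(_ isT) h1 h2 h3; rewrite subr0 ler_wpM2l//; lra.
Qed.

End Mechanism.
End Estimator.

(** * Privacy of the two-stage estimator *)

Section EstimatorPrivacy.
Context {R : realType}.
Variables (n L : nat) (x0 s T lam ef : R) (s0 : 0 < s).
Variables (W : finType) (coarse : {ffun 'I_n -> 'I_L.+1} -> W -> R).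
Variable dec : W -> 'I_L.+1.
Hypotheses (T0 : 0 < T) (lam0 : 0 <= lam) (ef0 : 0 <= ef).
Hypotheses (lamE : lam * (8 * T) = ef * n%:R) (n0 : (0 < n)%N).
Hypothesis coarse0 : forall e w, 0 <= coarse e w.
Hypothesis coarse1 : forall e, \sum_w coarse e w = 1.

Local Notation fine_law := (fine_law x0 s T lam).
Local Notation est := (estimator x0 T lam s0 coarse dec).

(** Given the coarse output, the fine stage hits [Y] with probability at most 1, so the slack [d] is
    not amplified. *)
Lemma estimator_dp (ec delta : R) :
  (forall e e', differ1 e e' -> exists d : W -> R,
    [/\ forall w, 0 <= d w, \sum_w d w <= delta &
        forall w, coarse e w <= expR ec * coarse e' w + d w]) ->
  differentially_private (ec + ef) delta est.
Proof.
move=> hc xs ys nxy Y mY; rewrite /est !output_lawE.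
have pmfm e := pmf_mech x0 s T lam dec coarse0 coarse1 e.
rewrite [leLHS](atomic_lawE _ _ (pmfm _)).
rewrite [X in (_ <= _ * X + _)%E](atomic_lawE _ _ (pmfm _)).
have := encode_neighbors (grid_enc x0 s L) nxy.
move: (encode _ xs) (encode _ ys) => e e' ee'.
have [d [d0 d1 hd]] := hc _ _ ee'.
rewrite -EFinM -EFinD lee_fin.
pose hit (e : {ffun 'I_n -> 'I_L.+1}) w :=
  \sum_g fine_law e (dec w) g * \1_Y (grid_pt x0 s g).
have mechE e1 : \sum_g mech x0 s T lam coarse dec e1 g * \1_Y (grid_pt x0 s g) =
    \sum_w coarse e1 w * hit e1 w.
  under eq_bigr do rewrite mulr_suml.
  rewrite exchange_big/=; apply: eq_bigr => w _.
  by rewrite mulr_sumr; apply: eq_bigr => g _; rewrite mulrA.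
have ind01 g : 0 <= (\1_Y (grid_pt x0 s g) : R) <= 1.
  by rewrite indicE; case: (_ \in _); rewrite ?lexx ?ler01.
have hit0 e1 w : 0 <= hit e1 w.
  rewrite sumr_ge0// => g _; apply: mulr_ge0; first by rewrite ltW// fine_law_gt0.
  by have /andP[] := ind01 g.
have hit1 e1 w : hit e1 w <= 1.
  rewrite -(sum_fine_law x0 s T lam e1 (dec w)) ler_sum// => g _.
  by have /andP[_ i1] := ind01 g; rewrite ler_piMr// ltW// fine_law_gt0.
have hitS w : hit e w <= expR ef * hit e' w.
  rewrite mulr_sumr ler_sum// => g _; rewrite mulrA; apply: ler_wpM2r.
    by have /andP[] := ind01 g.
  exact: fine_law_pure.
rewrite !mechE; apply: (@le_trans _ _
    (\sum_w (expR (ec + ef) * (coarse e' w * hit e' w) + d w))).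
  rewrite ler_sum// => w _.
  apply: (@le_trans _ _ ((expR ec * coarse e' w + d w) * hit e w)).
    by rewrite ler_wpM2r.
  rewrite mulrDl; apply: lerD; last by rewrite ler_piMr.
  rewrite expRD -!mulrA ler_pM2l ?expR_gt0// mulrCA.
  by rewrite ler_wpM2l.
by rewrite big_split/= -mulr_sumr lerD2l.
Qed.

(** The exponents of the two stages add up; [w0] provides a mixture component, which makes the
    output law positive on the whole grid. *)
Lemma estimator_zCDP (rc rho : R) (w0 : W) :
  (forall e w, 0 < coarse e w) ->
  (forall e e' a, differ1 e e' -> 1 < a ->
    renyi_sum a (coarse e) (coarse e') <= expR (rc * a * (a - 1))) ->
  rc + 4 * ef ^+ 2 <= rho ->
  zCDP rho est.
Proof.
move=> cgt0 hc hrho xs ys nxy a a1; rewrite /est !output_lawE.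
have pmfm e := pmf_mech x0 s T lam dec coarse0 coarse1 e.
have := encode_neighbors (grid_enc x0 s L) nxy.
move: (encode _ xs) (encode _ ys) => e e' ee'.
apply: renyi_atomic_law => //.
- move=> i j /addrI/(mulfI (lt0r_neq0 s0))/eqP; rewrite eqr_nat => /eqP.
  by [].
- move=> g; rewrite /mech (bigD1 w0)//= ltr_wpDr//.
    by rewrite sumr_ge0// => w _; rewrite mulr_ge0// ltW// fine_law_gt0.
  by rewrite mulr_gt0// fine_law_gt0.
apply: (@le_trans _ _ (expR (rc * a * (a - 1)) * expR (4 * ef ^+ 2 * a * (a - 1)))).
  apply: (renyi_sum_mix a1 (expR_ge0 _) (cgt0 e) (cgt0 e')) => [w g|w g||w].
  - exact: fine_law_gt0.
  - exact: fine_law_gt0.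
  - exact: hc.
  - apply: renyi_sum_pure => //.
    + by move=> g; exact: fine_law_gt0.
    + by move=> g; exact: fine_law_gt0.
    + exact: sum_fine_law.
    + exact: sum_fine_law.
    + exact: fine_law_pure.
    + by apply: fine_law_pure => //; exact: differ1_sym.
rewrite -expRD ler_expR -mulrDl -mulrDl ler_wpM2r//; first lra.
by rewrite ler_wpM2r//; lra.
Qed.

End EstimatorPrivacy.

(** * Numerical estimates for the sample sizes *)

Section NumericalBounds.
Context {R : realType}.

Lemma ln2_ge_half : 1 / 2 <= ln 2 :> R.
Proof.
rewrite -ler_expR lnK ?posrE//.
have := @expR_le1DxD2sqr R (1 / 2) (lexx _); rewrite expr2; lra.
Qed.

Lemma ln_inv_ge_half (beta : R) : 0 < beta -> beta <= 1 / 2 -> 1 / 2 <= ln (1 / beta).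
Proof.
move=> b0 b2; apply: (le_trans ln2_ge_half); rewrite ler_ln ?posrE ?divr_gt0//.
by rewrite ler_pdivlMr//; lra.
Qed.

(** The first copy of [ln (1 / beta)] yields the factor [beta], each further one a factor at most
    [1 / 2]. *)
Lemma expRN_small (beta x : R) (j : nat) : 0 < beta -> beta <= 1 / 2 ->
  j.+1%:R * ln (1 / beta) <= x -> expR (- x) <= beta / 2 ^+ j.
Proof.
move=> b0 b2 h; apply: (@le_trans _ _ (expR (- (j.+1%:R * ln (1 / beta))))).
  by rewrite ler_expR lerN2.
rewrite div1r lnV ?posrE// mulrN opprK expRM_natl lnK ?posrE// exprS.
rewrite ler_pM2l// -exprVn lerXn2r ?nnegrE ?invr_ge0 ?(ltW b0)//; lra.
Qed.

Lemma powR_scale (alpha k : R) : 2 <= k -> 0 < alpha ->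
  alpha `^ (k / (k - 1)) * alpha `^ (- (k - 1)^-1) = alpha.
Proof.
move=> k2 a0; rewrite -powRD; last by rewrite (gt_eqF a0) implybT.
have -> : k / (k - 1) + - (k - 1)^-1 = 1 by field; lra.
by rewrite powRr1// ltW.
Qed.

(** [L] is at most of order [r / alpha ^+ 2]. The resulting [ln (1 / alpha)] is bounded crudely by
    [A^-1 ^+ 2], whose square root matches the second term of the zCDP sample size. *)
Lemma up_log_grid_le (alpha r T A : R) (L : nat) :
  0 < alpha -> alpha <= 1 -> 1 < r -> alpha * T <= 1088 ->
  0 < A -> A <= alpha ->
  L%:R <= 2 * (r + T) / (alpha / 16) + 1 ->
  (up_log 2 L.+1)%:R <= 25 * (A^-1 ^+ 2 + ln r).
Proof.
move=> a0 a1 r1 aT A0 Aa hL.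
set v := alpha^-1.
have v1 : 1 <= v by rewrite /v invf_ge1.
have vA : v <= A^-1 by rewrite /v lef_pV2.
have LE : L.+1%:R <= 2 ^+ 16 * (r * v ^+ 2) :> R.
  have -> : 2 ^+ 16 = 256 * 256 :> R by rewrite -natrX -natrM.
  have Tv : T <= 1088 * v by rewrite /v ler_pdivlMr// mulrC.
  have e1 : 2 * (r + T) / (alpha / 16) = 32 * (r + T) * v.
    by rewrite /v; field; rewrite gt_eqF.
  have h1 : T * v <= 1088 * v * v by rewrite ler_wpM2r//; lra.
  have vv : v <= v * v by rewrite ler_peMr//; lra.
  have rv : r * v <= r * (v * v) by rewrite ler_pM2l//; lra.
  have vr : v * v <= r * (v * v) by rewrite ler_peMl//; lra.
  by rewrite -natr1 expr2; move: hL; rewrite e1; lra.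
have l0 : 0 <= ln r by apply: ln_ge0; lra.
have lm : 2 ^+ (up_log 2 L.+1).-1 <= L.+1%:R :> R.
  rewrite -natrX ler_nat.
  have [->|Lgt0] := posnP L; first by rewrite up_log1.
  by have /andP[/ltnW] := @up_log_bounds 2 L.+1 isT Lgt0.
set m := up_log 2 L.+1 in lm *.
have key : m.-1%:R * ln 2 <= 16%:R * ln 2 + (ln r + 2%:R * ln v).
  have v0 : 0 < v by lra.
  have r0 : 0 < r by lra.
  have lnX (j : nat) (x : R) : 0 < x -> j%:R * ln x = ln (x ^+ j).
    by move=> x0; rewrite lnXn// mulr_natl.
  rewrite !lnX// -lnM ?posrE ?exprn_gt0// -lnM ?posrE ?mulr_gt0 ?exprn_gt0//.
  rewrite ler_ln ?posrE ?mulr_gt0 ?exprn_gt0//.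
  exact: le_trans LE.
have lv : ln v <= v - 1.
  have -> : v = 1 + (v - 1) by ring.
  by rewrite {2}(_ : 1 + (v - 1) = v); [apply: le_ln1Dx; lra|ring].
have mm : m%:R <= m.-1%:R + 1 :> R by rewrite natr1 ler_nat leqSpred.
have AA : A^-1 <= A^-1 ^+ 2 by rewrite expr2 ler_peMr//; lra.
have := ln2_ge_half; have : 0 <= m.-1%:R :> R by [].
by nra.
Qed.

End NumericalBounds.

Lemma ler_mulr_pdiv (R : realFieldType) (C x y z : R) : 0 < y ->
  (C * (x / y) <= z) = (C * x <= z * y).
Proof. by move=> y0; rewrite mulrA ler_pdivrMr. Qed.

Lemma ler_mulr_sum3 (R : realFieldType) (C a b c x : R) :
  0 <= C -> 0 <= a -> 0 <= b -> 0 <= c -> C * (a + b + c) <= x ->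
  [/\ C * a <= x, C * b <= x & C * (b + c) <= x].
Proof. by move=> C0 a0 b0 c0 h; split; nra. Qed.

Lemma sample_size_ge16 (R : realFieldType) (l : R) :
  1 / 2 <= l -> 16 <= 2000 * 1000 * l.
Proof. lra. Qed.

Lemma sqr_sum_le (R : realFieldType) (x y : R) : 0 <= x * y ->
  25 * (x ^+ 2 + y ^+ 2) <= (5 * (x + y)) ^+ 2.
Proof. by rewrite !expr2; lra. Qed.

Lemma stable_threshold_le (R : realFieldType) (eta d l x y : R) :
  2000 * 1000 * (l + x) <= 6 * y -> d <= 2 * x -> 16 * eta <= y ->
  0 <= d -> 1 / 2 <= l -> eta + (d + 3 * l) <= y / 8.
Proof. lra. Qed.

Lemma code_threshold_le (R : realFieldType) (l v w : R) :
  0 <= l -> 0 <= w -> v <= 5 * w -> 20 * l * (128 * v) <= 2000 * 1000 * (l * w).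
Proof.
move=> l0 w0 vw; have := ler_wpM2l l0 vw; have := mulr_ge0 l0 w0; lra.
Qed.

(** * Choice of parameters in both privacy models *)

Section MainBounds.
Context {R : realType}.
Variables (k r alpha beta : R).
Hypotheses (k2 : 2 <= k) (r1 : 1 < r) (alpha0 : 0 < alpha) (alpha1 : alpha <= 1).
Hypotheses (beta0 : 0 < beta) (beta2 : beta <= 1 / 2).

Variable C : R.
Hypothesis CE : C = 2000 * 1000.

Let s : R := alpha / 16.
Let T : R := 4 * (272 * alpha `^ (- (k - 1)^-1)).
Let L : nat := (Num.truncn (2 * (r + T) / s)).+1.
Let A : R := alpha `^ (k / (k - 1)).
Let l : R := ln (1 / beta).

Let s0 : 0 < s. Proof. by rewrite /s divr_gt0. Qed.

Let T_ge1088 : 1088 <= T.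
Proof. exact: (T_ge alpha0 alpha1 k2 erefl). Qed.

Let T0 : 0 < T. Proof. by have := T_ge1088; lra. Qed.

Let sT : s <= T.
Proof. by have := T_ge1088; have := alpha1; rewrite /s; lra. Qed.

Let A0 : 0 < A. Proof. by rewrite powR_gt0. Qed.

Let A_le : A <= alpha.
Proof.
apply: ge1r_powR; first by rewrite alpha0.
by have := k2 => k2'; rewrite ler_pdivlMr; lra.
Qed.

Let AT : A * T = 1088 * alpha.
Proof. by rewrite -[X in _ = _ * X](powR_scale k2 alpha0) -/A /T; ring. Qed.

Let l_ge : 1 / 2 <= l. Proof. exact: ln_inv_ge_half. Qed.

Let grid_ge : 2 * (r + T) <= s * L%:R.
Proof.
by rewrite [leRHS]mulrC -ler_pdivrMr// ltW// /L truncnS_gt.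
Qed.

Let L_le : L%:R <= 2 * (r + T) / s + 1.
Proof.
rewrite /L -natr1 lerD2r truncn_le divr_ge0 ?(ltW s0)//.
by have := r1; have := T0; lra.
Qed.

Let C_gt0 : 0 < C.
Proof. by rewrite CE; apply: mulr_gt0; rewrite ltr0n. Qed.

Let C_ge0 : 0 <= C := ltW C_gt0.

Lemma concentration_bound (n : nat) :
  C * (l / alpha ^+ 2) <= n%:R ->
  2 * expR (- (n%:R * alpha ^+ 2 / (200 * 200))) <= beta / 3.
Proof.
move=> h; have b0 := beta0.
have a2 : 0 < alpha ^+ 2 by rewrite exprn_gt0.
have h' : 2000 * 1000 * l <= n%:R * alpha ^+ 2.
  by rewrite -CE -ler_mulr_pdiv.
have : expR (- (n%:R * alpha ^+ 2 / (200 * 200))) <= beta / 2 ^+ 3.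
  apply: expRN_small => //; rewrite -/l; have := l_ge => l0.
  by rewrite ler_pdivlMr; lra.
have -> : 2 ^+ 3 = 8 :> R by rewrite -natrX.
lra.
Qed.

(** The factor 3 allows [ef] to be only a half or a third of the whole budget. *)
Lemma fine_bound (n : nat) (ef lam : R) : 0 < ef ->
  lam * (8 * T) = ef * n%:R ->
  C * (l / (ef * A)) <= 3 * n%:R ->
  2 * expR (- (lam * s)) <= beta / 3.
Proof.
move=> ef0 lamE h; have b0 := beta0.
have h' : 2000 * 1000 * l <= 3 * n%:R * (ef * A).
  by rewrite -CE -ler_mulr_pdiv ?mulr_gt0.
(* By [AT], [T] is of order [alpha / A]: the exponent [k / (k - 1)] arises here. *)
have lsE : lam * s = n%:R * (ef * A) / (128 * 1088).
  apply: (mulIf (lt0r_neq0 T0)).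
  have -> : lam * s * T = lam * (8 * T) * (alpha / 128) by rewrite /s; field.
  rewrite lamE.
  have -> : n%:R * (ef * A) / (128 * 1088) * T =
      n%:R * ef * (A * T) / (128 * 1088) by field.
  by rewrite AT; field.
have : expR (- (lam * s)) <= beta / 2 ^+ 3.
  apply: expRN_small => //; rewrite -/l lsE; have := l_ge => l0.
  by rewrite ler_pdivlMr; lra.
have -> : 2 ^+ 3 = 8 :> R by rewrite -natrX.
lra.
Qed.

Lemma dp_part (eps delta : R) (n : nat) : 0 < eps -> 0 < delta -> delta <= 1 ->
  C * (l / alpha ^+ 2 + l / (eps * A) + ln (1 / delta) * l / eps) <= n%:R ->
  exists M : randomized_algorithm R n,
    differentially_private eps delta M /\ estimates_mean k r alpha beta M.
Proof.
move=> e0 d0 d1 hn; have lge := l_ge; have l0 : 0 <= l by lra.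
have ld0 : 0 <= ln (1 / delta) by rewrite ln_ge0// ler_pdivlMr// mul1r.
have t1 : 0 <= l / alpha ^+ 2 by rewrite divr_ge0// exprn_ge0// ltW.
have t2 : 0 <= l / (eps * A) by rewrite divr_ge0// mulr_ge0 ?(ltW A0) ?(ltW e0).
have t3 : 0 <= ln (1 / delta) * l / eps by rewrite divr_ge0 ?mulr_ge0 ?(ltW e0).
have [h1 h2 h23] := ler_mulr_sum3 C_ge0 t1 t2 t3 hn.
(* As [A <= 1], the second term dominates [l / eps], which the histogram needs even when
   [ln (1 / delta)] vanishes. *)
have {}h23 : C * (l / eps + ln (1 / delta) * l / eps) <= n%:R.
  apply: le_trans h23; rewrite ler_wpM2l// lerD2r ler_wpM2l//.
  rewrite lef_pV2 ?posrE ?mulr_gt0// ler_piMr ?(ltW e0)//.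
  exact: le_trans A_le alpha1.
have n16 : 16 <= n%:R :> R.
  apply: le_trans h1; apply: (@le_trans _ _ (C * l)).
    by rewrite CE; exact: sample_size_ge16.
  rewrite ler_wpM2l// ler_peMr// invf_ge1 ?exprn_gt0// exprn_ile1// ltW//.
have n0 : (0 < n)%N by rewrite -(ltr0n R); apply: lt_le_trans n16; rewrite ltr0n.
pose lam := eps / 2 * n%:R / (8 * T).
have lamE : lam * (8 * T) = eps / 2 * n%:R.
  by rewrite divfK// mulf_neq0 ?gt_eqF.
have lam0 : 0 <= lam.
  apply: divr_ge0; last by rewrite mulr_ge0// ltW.
  by rewrite mulr_ge0// divr_ge0// ltW.
(* [stable_law_dp] costs [3 * eta], half of the budget. *)
pose eta := eps / 6.
have eta0 : 0 <= eta by rewrite divr_ge0// ltW.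
pose coarse := @stable_law R n L _ eta delta (@bin_of R L s T).
exists (@estimator R n L (- (r + T)) s T lam s0 _ coarse id); split.
  have -> : eps = 3 * eta + eps / 2 by rewrite /eta; field.
  apply: estimator_dp => //.
  - by move=> e w; exact: stable_law_ge0.
  - by move=> e; exact: sum_stable_law.
  - by move=> e e' ee'; exact: stable_law_dp.
apply: estimator_estimates => //.
- by move=> e w; exact: stable_law_ge0.
- by move=> e; exact: sum_stable_law.
- exact: ltW.
- exact: concentration_bound.
- apply: (fine_bound _ lamE); first by rewrite divr_gt0.
  rewrite (_ : l / (eps / 2 * A) = 2 * (l / (eps * A))); last first.
    by field; rewrite !gt_eqF.
  rewrite mulrCA; apply: ler_pM => //; first by rewrite mulr_ge0.
  by rewrite ler_nat.
move=> e b1 b2 few; apply: (le_trans (stable_law_far _ _ _ few)) => //.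
have eta_n : eta + (ln (1 / delta) + 3%:R * l) <= eta * n%:R / 8.
  have h3 : C * (l + ln (1 / delta) * l) <= n%:R * eps.
    by rewrite -(ler_mulr_pdiv _ _ _ e0) [(l + _) / eps]mulrDl.
  have h4 : ln (1 / delta) <= 2 * (ln (1 / delta) * l).
    by rewrite mulrCA ler_peMr// mulrC -ler_pdivrMr.
  have h5 : 16 * eta <= n%:R * eta by rewrite ler_wpM2r.
  have h6 : n%:R * eps = 6 * (n%:R * eta) by rewrite /eta; field.
  rewrite h6 CE in h3; have -> : eta * n%:R / 8 = n%:R * eta / 8 by ring.
  exact: stable_threshold_le h3 h4 h5 ld0 lge.
have : expR (- (eta * n%:R / 8 - eta - ln (1 / delta))) <= beta / 2 ^+ 2.
  apply: expRN_small => //; rewrite -/l -addrA -opprD lerBrDl.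
  by rewrite -addrA.
have -> : - (eta * n%:R / 8 - eta - ln (1 / delta)) =
    (eta - eta * n%:R / 8) + ln (1 / delta) by ring.
rewrite [expR (_ + ln _)]expRD lnK ?posrE ?divr_gt0// div1r => /le_trans; apply.
rewrite ler_pM2l// lef_pV2 ?posrE ?exprn_gt0// -natrX ler_nat.
by [].
Qed.

Lemma zCDP_part (rho : R) (n : nat) : 0 < rho ->
  C * (l / alpha ^+ 2 + l / (Num.sqrt rho * A) +
    Num.sqrt (ln r) * l / Num.sqrt rho) <= n%:R ->
  exists M : randomized_algorithm R n,
    zCDP rho M /\ estimates_mean k r alpha beta M.
Proof.
move=> rho0 hn; have lge := l_ge; have l_gt0 : 0 < l by lra.
have l0 := ltW l_gt0.
set q := Num.sqrt rho in hn *; have q0 : 0 < q by rewrite sqrtr_gt0.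
have qq : q ^+ 2 = rho by rewrite sqr_sqrtr// ltW.
set S := Num.sqrt (ln r) in hn *; have S0 : 0 <= S by exact: sqrtr_ge0.
have lr0 : 0 <= ln r by rewrite ln_ge0// ltW.
have SS : S ^+ 2 = ln r by rewrite sqr_sqrtr.
have t1 : 0 <= l / alpha ^+ 2 by rewrite divr_ge0// exprn_ge0// ltW.
have t2 : 0 <= l / (q * A) by rewrite divr_ge0// mulr_ge0 ?(ltW A0) ?(ltW q0).
have t3 : 0 <= S * l / q by rewrite divr_ge0 ?mulr_ge0 ?(ltW q0).
have [h1 h2 h23] := ler_mulr_sum3 C_ge0 t1 t2 t3 hn.
have {}h23 : C * (l * (A^-1 + S)) <= n%:R * q.
  rewrite -(ler_mulr_pdiv _ _ _ q0).
  rewrite (_ : l * (A^-1 + S) / q = l / (q * A) + S * l / q)//.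
  by field; rewrite !gt_eqF.
have n0 : (0 < n)%N.
  rewrite -(ltr0n R); apply: lt_le_trans h1.
  by rewrite mulr_gt0// divr_gt0// exprn_gt0.
pose ef := q / 3; have ef0 : 0 < ef by rewrite divr_gt0.
pose lam := ef * n%:R / (8 * T).
have lamE : lam * (8 * T) = ef * n%:R.
  by rewrite divfK// mulf_neq0 ?gt_eqF.
have lam0 : 0 <= lam.
  apply: divr_ge0; last by rewrite mulr_ge0// ltW.
  by rewrite mulr_ge0// ltW.
pose m := up_log 2 L.+1.
have m0 : (0 < m)%N by rewrite /m up_log_gt0.
have mle : m%:R <= 25 * (A^-1 ^+ 2 + S ^+ 2).
  rewrite SS; apply: (@up_log_grid_le _ alpha r T) => //.
  exact: (alphaT_le alpha0 alpha1 k2 erefl).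
have mR : 0 < m%:R :> R by rewrite ltr0n.
set v := Num.sqrt (m%:R : R).
have v0 : 0 < v by rewrite sqrtr_gt0.
have vv : v ^+ 2 = m%:R by rewrite sqr_sqrtr// ltW.
have iA : 0 < A^-1 by rewrite invr_gt0.
have v_le : v <= 5 * (A^-1 + S).
  rewrite -(@ler_pXn2r _ 2)// ?nnegrE ?(ltW v0)//; last first.
    by rewrite mulr_ge0// addr_ge0// ltW.
  rewrite vv; apply: (le_trans mle).
  have : 0 <= A^-1 * S by rewrite mulr_ge0// ltW.
  exact: sqr_sum_le.
(* The coarse cost [128 * eta ^+ 2 * m] becomes [rho / 2]; with [4 * ef ^+ 2 = 4 / 9 * rho] the
   total is [17 / 18 * rho]. *)
pose eta := q / (16 * v).
have eta0 : 0 <= eta by rewrite divr_ge0 ?mulr_ge0// ltW.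
(* Twenty copies leave [beta / 2 ^+ 19]: nine halvings pay for the [2 ^ 9] letters, and the other
   ten give [2 ^ 10 >= 3 * 256]. *)
have eta_n : 20%:R * l <= eta * n%:R / 8.
  have -> : eta * n%:R / 8 = n%:R * q / (128 * v).
    by rewrite /eta; field; rewrite gt_eqF.
  rewrite ler_pdivlMr ?mulr_gt0//; apply: le_trans h23; rewrite CE.
  by apply: code_threshold_le => //; rewrite addr_ge0// ltW.
pose Alph := {ffun 'I_9 -> bool}.
have cA : #|Alph| = (2 ^ 9)%N by rewrite card_ffun card_bool card_ord.
have [c hc] := code_exists cA (up_logP L.+1 (isT : (1 < 2)%N)).
pose code (b : 'I_L.+1) := c b.
have dist b b' : b != b' -> (agree (code b) (code b') < m)%N.
  rewrite neq_ltn => /orP[bb'|bb']; last rewrite agreeC.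
    by apply: hc; rewrite bb' ltn_ord.
  by apply: hc; rewrite bb' ltn_ord.
pose a : Alph := [ffun=> true].
pose coarse := @code_law R n L m _ Alph eta code (@bin_of R L s T).
exists (@estimator R n L (- (r + T)) s T lam s0 _ coarse (decode code)); split.
  apply: (@estimator_zCDP _ _ _ _ _ _ _ ef _ _ _ _ T0 lam0 (ltW ef0) lamE n0 _ _
    (128 * eta ^+ 2 * m%:R) rho [ffun=> a]).
  - by move=> e w; rewrite ltW// code_law_gt0.
  - by move=> e; exact: sum_code_law a.
  - by move=> e w; exact: code_law_gt0.
  - by move=> e e' a' ee' a'1; exact: code_law_renyi.
  - have -> : 128 * eta ^+ 2 * m%:R = rho / 2.
      by rewrite /eta -vv -qq; field; rewrite gt_eqF.
    have -> : 4 * ef ^+ 2 = 4 / 9 * rho by rewrite /ef -qq; field.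
    by rewrite -[rho / 2]mulrC -mulrDl ler_piMl ?ltW//; lra.
apply: estimator_estimates => //.
- by move=> e w; rewrite ltW// code_law_gt0.
- by move=> e; exact: sum_code_law a.
- exact: ltW.
- exact: concentration_bound.
- apply: (fine_bound ef0 lamE).
  rewrite (_ : l / (ef * A) = 3 * (l / (q * A))); last first.
    by rewrite /ef; field; rewrite !gt_eqF.
  by rewrite mulrCA ler_pM2l.
move=> e b1 b2' few.
have -> : beta / 3 = 256 / (256 * 3 / beta) by field; rewrite gt_eqF.
apply: (code_law_far dist a eta0 m0 _ few).
  by rewrite -mulrA ler_peMr// ler_pdivlMr// mul1r (le_trans beta2)//; lra.
have : expR (- (eta * n%:R / 8)) <= beta / 2 ^+ 19 by apply: expRN_small.
rewrite invf_div cA natrX.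
have -> : 2 ^+ 19 = 2 ^+ 9 * 2 ^+ 10 :> R by rewrite -exprD.
move=> h; apply: (@le_trans _ _ (2 ^+ 9 * (beta / (2 ^+ 9 * 2 ^+ 10)))).
  by rewrite ler_pM2l// exprn_gt0.
have -> : 2 ^+ 9 * (beta / (2 ^+ 9 * 2 ^+ 10)) = beta / 2 ^+ 10.
  by rewrite invfM mulrCA mulVKf// expf_neq0.
by rewrite ler_pM2l// lef_pV2 ?posrE ?mulr_gt0 ?exprn_gt0// -natrM -natrX ler_nat.
Qed.

End MainBounds.

Theorem theorem3p6 (R : realType) :
  exists2 c : R, 0 < c &
  forall k r : R, 2 <= k -> 1 < r ->
  forall eps delta rho alpha beta : R,
    0 < eps -> 0 < delta <= 1 -> 0 < rho -> 0 < alpha <= 1 ->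
    0 < beta <= 1 / 2 ->
  (forall n : nat,
     c * (ln (1 / beta) / alpha ^+ 2
          + ln (1 / beta) / (eps * alpha `^ (k / (k - 1)))
          + ln (1 / delta) * ln (1 / beta) / eps) <= n%:R ->
     exists M : randomized_algorithm R n,
       differentially_private eps delta M /\
       estimates_mean k r alpha beta M) /\
  (forall n : nat,
     c * (ln (1 / beta) / alpha ^+ 2
          + ln (1 / beta) / (Num.sqrt rho * alpha `^ (k / (k - 1)))
          + Num.sqrt (ln r) * ln (1 / beta) / Num.sqrt rho) <= n%:R ->
     exists M : randomized_algorithm R n,
       zCDP rho M /\
       estimates_mean k r alpha beta M).
Proof.
(* [fine_bound] is the most demanding use, requiring [3 * 4 * 128 * 1088 = 1671168]. *)
exists (2000 * 1000); first by apply: mulr_gt0; rewrite ltr0n.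
move=> k r k2 r1 eps delta rho alpha beta e0 /andP[d0 d1] rho0 /andP[a0 a1].
move=> /andP[b0 b2]; split => n hn; first exact: (dp_part _ _ _ _ _ _ erefl _ _ _ hn).
exact: (zCDP_part _ _ _ _ _ _ erefl _ hn).
Qed.
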